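(* Let $(\rho,m)$ be a smooth solution on $[0,T]$ of the compressible network flow problem (F1)--(F6) defined in the context. Then, for all $0<t\le T$, $$\frac{d}{dt}\int_{\mathcal E}\rho\,dx=0$$ and $$\frac{d}{dt}\int_{\mathcal E}\Big(\frac{m^2}{2\rho}+P(\rho)\Big)dx+\int_{\mathcal E}\Big(\frac{a}{\rho^2}|\partial_x'm|^2+b\frac{|m|^3}{\rho^2}\Big)dx=0,$$ i.e., the total mass is conserved and the total energy is dissipated at any point in time.
   Context: Network. $\mathcal G=(\mathcal V,\mathcal E,\ell)$ is a finite, directed, connected graph with vertex set $\mathcal V$, edge set $\mathcal E\subset\mathcal V\times\mathcal V$, and lengths $\ell_e>0$, $e\in\mathcal E$. An edge $e=(v_1,v_2)$ is identified with the interval $[0,\ell_e]$ ($v_1$ corresponding to $0$, $v_2$ to $\ell_e$), and $n_e(v_1)=-1$, $n_e(v_2)=1$. $\mathcal E(v)$ is the set of edges incident on $v$; $\mathcal V_0=\{v:|\mathcal E(v)|\ge2\}$ are the inner vertices, $\mathcal V_\partial=\mathcal V\setminus\mathcal V_0$ the boundary vertices. Function spaces. For a function $u$ on the network, $u_e=u|_e$. $L^2(\mathcal E)$, $L^\infty(\mathcal E)$, $H^s(\mathcal E)$ are the spaces of functions with $u_e\in L^2(e)$, $L^\infty(e)$, $H^s(e)$, respectively, for every $e$ (no continuity at vertices). $\int_{\mathcal E}u\,dx=\sum_e\int_0^{\ell_e}u_e\,dx$. The broken derivative $\partial_x'u$ is $(\partial_x'u)|_e=\partial_x(u_e)$. $u_e(v)$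 is the value of $u_e$ at the endpoint $v$. $H^1_+(\mathcal E)=\{\rho\in H^1(\mathcal E):\exists\,\underline\rho>0,\ \rho\ge\underline\rho\text{ a.e. on }\mathcal E\}$. Data. $a_e,b_e\ge0$ and $c_e>0$ are constants on each edge and $a,b$ denote the edgewise constant functions with values $a_e,b_e$; $\gamma>1$; $p_e(\rho)=c_e\rho^\gamma$, $P_e(\rho)=\frac{c_e}{\gamma-1}\rho^\gamma$; $P(\rho)$ denotes the function with restriction $P_e(\rho_e)$ to $e$. Flow problem: (F1) $\partial_t\rho_e+\partial_xm_e=0$ for all $e\in\mathcal E$; (F2) $\partial_tm_e+\partial_x\big(\frac{m_e^2}{\rho_e}+p_e(\rho_e)\big)=a_e\rho_e\,\partial_x\big(\frac1{\rho_e^2}\partial_xm_e\big)-b_e\frac{|m_e|m_e}{\rho_e}$ for all $e\in\mathcal E$; (F3) $p_e(\rho)=c_e\rho^\gamma$ and $P_e(\rho)=\frac{c_e}{\gamma-1}\rho^\gamma$ for all $e\in\mathcal E$; (F4) $\sum_{e\in\mathcal E(v)}m_e(v)n_e(v)=0$ for all $v\in\mathcal V_0$; (F5) for every $v\in\mathcal V_0$ there is a value $h_v$ (depending on time but not on $e$) with $\frac{m_e(v)^2}{2\rho_e(v)^2}+P_e'(\rho_e(v))=h_v+\frac{a_e}{\rho_e(v)^2}\partial_xm_e(v)$ for all $e\in\mathcal E(v)$; (F6) $m_e(v)n_e(v)=0$ for all $v\in\mathcal V_\partial$, $e\in\mathcal E(v)$. A smooth solution on $[0,T]$ is a pair $(\rho,m)\in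 C^1([0,T];L^\infty(\mathcal E)\times L^2(\mathcal E))\cap C([0,T];H^1_+(\mathcal E)\times H^2(\mathcal E))$ satisfying these equations for all $t>0$ (i.e. $0<t\le T$) and a.e. on $\mathcal E$. *)

(* Defs.v *)
From HB Require Import structures.
From mathcomp Require Import all_boot all_order all_algebra.
From mathcomp Require Import all_classical all_reals all_analysis.
Set Implicit Arguments.
Unset Strict Implicit.
Unset Printing Implicit Defensive.
Import Order.TTheory GRing.Theory Num.Theory.
Import numFieldNormedType.Exports.
Local Open Scope classical_set_scope.
Local Open Scope ring_scope.

(** * Sobolev spaces on an interval [0, l]

    An element of a function space on (0, l) is represented by a function
    R -> R, of which only the restriction to [0, l] matters, up to null sets:
    values at the end points are those of the continuous representative. *)
Section Interval.
Context {R : realType}.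
Implicit Types (l : R) (u g phi : R -> R).
Local Notation mu := (@lebesgue_measure R).

(* Extension by zero, through which L^p(0, l) embeds into L^p(R). *)
Definition zext l u : R -> R := u \_ `[0, l].

Definition in_Lp (p : \bar R) l u : Prop := zext l u \in Lfun mu p.

Definition Lp_norm (p : \bar R) l u : \bar R := 'N[mu]_p[EFin \o zext l u]%E.

(* Test functions of class C^1 with compact support in the open interval
   (the class used e.g. by Brezis to define W^{1,p} of an interval; it gives
   the same weak derivatives as C^oo test functions). *)
Definition test_fun l phi : Prop :=
  [/\ forall x : R, derivable phi x 1,
      continuous phi^`()%classic,
      compact (closure [set x | phi x != 0]) &
      closure [set x | phi x != 0] `<=` `]0, l[].

Definition is_weak_deriv l u g : Prop :=
  in_Lp 2%:E l g /\
  forall phi, test_fun l phi ->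
    \int[mu]_(x in `[0, l]) (u x * (phi^`())%classic x) =
    - \int[mu]_(x in `[0, l]) (g x * phi x).

(* A weak derivative in L^2(0, l); it is unique up to null sets, and it is
   meaningless when there is none. *)
Definition wderiv l u : R -> R := get [set g | is_weak_deriv l u g].

Definition in_H1 l u : Prop :=
  in_Lp 2%:E l u /\ exists g, is_weak_deriv l u g.

Definition in_H2 l u : Prop := in_H1 l u /\ in_H1 l (wderiv l u).

(* The continuous representative on [0, l] of an element of H^1(0, l). *)
Definition cont_rep l u : R -> R :=
  get [set w : R -> R | {within `[0, l], continuous w} /\
                        \forall x \ae mu, x \in `[0, l] -> w x = u x].

End Interval.

(** * Networks *)

(* No loops: for e = (v, v) the sign n_e(v) and the value u_e(v) would not be
   defined.  Connectedness is that of the underlying undirected graph. *)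
Record network (R : realType) := Network {
  vertex : finType;
  edge_set : {set vertex * vertex};
  len : {e : vertex * vertex | e \in edge_set} -> R;
  len_gt0 : forall e, 0 < len e;
  network_loopless : forall v, (v, v) \notin edge_set;
  network_connected : forall v w, connect
    (fun x y => ((x, y) \in edge_set) || ((y, x) \in edge_set)) v w
}.

Definition edge (R : realType) (G : network R) : finType :=
  {e : vertex G * vertex G | e \in edge_set G}.

(* u e is the restriction u_e, relevant on [0, len e] only. *)
Definition netfun (R : realType) (G : network R) : Type := edge G -> R -> R.

Section Network.
Context {R : realType} {G : network R}.
Implicit Types (e : edge G) (v : vertex G) (u : netfun G).
Local Notation mu := (@lebesgue_measure R).

Definition incident e v : bool := (v == (val e).1) || (v == (val e).2).

Definition inner v : bool := (2 <= #|[set e : edge G | incident e v]|)%N.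

Definition normal e v : R :=
  if v == (val e).1 then -1 else if v == (val e).2 then 1 else 0.

Definition endpoint e v : R := if v == (val e).1 then 0 else len e.

(* u_e(v) *)
Definition trace u e v : R := cont_rep (len e) (u e) (endpoint e v).

(* The broken derivative. *)
Definition bderiv u : netfun G := fun e => wderiv (len e) (u e).

Definition net_int u : R := \sum_(e : edge G) \int[mu]_(x in `[0, len e]) u e x.

Definition net_L2 u : Prop := forall e, in_Lp 2%:E (len e) (u e).
Definition net_Loo u : Prop := forall e, in_Lp +oo%E (len e) (u e).
Definition net_H1 u : Prop := forall e, in_H1 (len e) (u e).
Definition net_H2 u : Prop := forall e, in_H2 (len e) (u e).

Definition net_H1pos u : Prop :=
  net_H1 u /\ exists2 r : R, 0 < r &
    forall e : edge G, \forall x \ae mu, x \in `[0, len e] -> r <= u e x.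

Local Open Scope ereal_scope.

Definition norm_Loo u : \bar R :=
  \big[maxe/0]_(e : edge G) Lp_norm +oo (len e) (u e).

Definition norm_L2 u : \bar R :=
  (\sum_(e : edge G) Lp_norm 2%:E (len e) (u e) `^ 2) `^ 2^-1.

Definition norm_H1 u : \bar R :=
  (norm_L2 u `^ 2 + norm_L2 (bderiv u) `^ 2) `^ 2^-1.

Definition norm_H2 u : \bar R :=
  (norm_L2 u `^ 2 + norm_L2 (bderiv u) `^ 2
   + norm_L2 (bderiv (bderiv u)) `^ 2) `^ 2^-1.

Local Close Scope ereal_scope.

(** * Time regularity of functions [0, T] -> X, X a space of functions on the
    network with norm N; at the end points of [0, T] limits are one-sided. *)

Definition time_cont (X : netfun G -> Prop) (N : netfun G -> \bar R) (T : R)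
    (u : R -> netfun G) : Prop :=
  forall t : R, t \in `[0, T] ->
    X (u t) /\
    N (fun e x => u s e x - u t e x) @[s --> within `[0, T] (nbhs t)]
      --> 0%E.

(* u is in C^1([0, T]; X), with derivative du *)
Definition time_C1 (X : netfun G -> Prop) (N : netfun G -> \bar R) (T : R)
    (u du : R -> netfun G) : Prop :=
  [/\ forall t : R, t \in `[0, T] -> X (u t),
      time_cont X N T du &
      forall t : R, t \in `[0, T] ->
        N (fun e x => (u s e x - u t e x) / (s - t) - du t e x)
          @[s --> within `[0, T] t^'] --> 0%E].

End Network.

(* The derivative at t of a real function of time on [0, T] (one-sided at the
   end points). *)
Definition is_time_deriv (R : realType) (T : R) (f : R -> R) (t d : R) : Prop :=
  (f s - f t) / (s - t) @[s --> within `[0, T] t^'] --> d.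

(** * The flow problem *)
Section Flow.
Context {R : realType} {G : network R}.
Variables (a b c : edge G -> R) (gamma : R).
Local Notation mu := (@lebesgue_measure R).

Definition pressure (e : edge G) (r : R) : R := c e * r `^ gamma.

Definition potential (e : edge G) (r : R) : R :=
  c e / (gamma - 1) * r `^ gamma.

(* The equations at a fixed time; drho and dm stand for the time derivatives
   of rho and m at that time. *)
Record flow_equations (rho m drho dm : netfun G) : Prop := FlowEquations {
  flow_mass : forall e : edge G, \forall x \ae mu, x \in `[0, len e] ->
    drho e x + wderiv (len e) (m e) x = 0;
  flow_momentum : forall e : edge G, \forall x \ae mu, x \in `[0, len e] ->
    dm e x + wderiv (len e)
               (fun y => m e y ^+ 2 / rho e y + pressure e (rho e y)) x =
    a e * rho e x *
      wderiv (len e) (fun y => 1 / rho e y ^+ 2 * wderiv (len e) (m e) y) x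
    - b e * (`|m e x| * m e x / rho e x);
  flow_kirchhoff : forall v, inner v ->
    \sum_(e : edge G | incident e v) trace m e v * normal e v = 0;
  flow_coupling : forall v, inner v -> exists h : R,
    forall e, incident e v ->
      trace m e v ^+ 2 / (2 * trace rho e v ^+ 2)
        + (potential e)^`()%classic (trace rho e v) =
      h + a e / trace rho e v ^+ 2 * trace (bderiv m) e v;
  flow_boundary : forall v, ~~ inner v -> forall e, incident e v ->
    trace m e v * normal e v = 0
}.

Definition smooth_solution (T : R) (rho m : R -> netfun G) : Prop :=
  exists drho dm : R -> netfun G,
    [/\ time_C1 net_Loo norm_Loo T rho drho,
        time_C1 net_L2 norm_L2 T m dm,
        time_cont net_H1pos norm_H1 T rho,
        time_cont net_H2 norm_H2 T m &
        forall t : R, 0 < t <= T ->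
          flow_equations (rho t) (m t) (drho t) (dm t)].

Definition mass (rho : netfun G) : R := net_int rho.

Definition energy (rho m : netfun G) : R :=
  net_int (fun e x => m e x ^+ 2 / (2 * rho e x) + potential e (rho e x)).

Definition dissipation (rho m : netfun G) : R :=
  net_int (fun e x => a e / rho e x ^+ 2 * `|bderiv m e x| ^+ 2
                      + b e * (`|m e x| ^+ 3 / rho e x ^+ 2)).

End Flow.

(* Main.v *)
Require Import Defs.
From mathcomp Require Import all_boot all_order all_algebra.
From mathcomp Require Import all_classical all_reals all_analysis.
From mathcomp Require Import measurable_realfun ess_sup_inf ring lra.
Import Order.TTheory GRing.Theory Num.Theory.
Import numFieldNormedType.Exports.
Local Open Scope classical_set_scope.
Local Open Scope ring_scope.
Set Implicit Arguments.
Unset Strict Implicit.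
Unset Printing Implicit Defensive.

(** On an edge, an element of H^1 is the integral of its weak derivative (du
    Bois-Reymond), so products, reciprocals and powers of continuous
    representatives obey the usual calculus.  With the mass and momentum
    equations, the energy power [m/rho dm + (P'(rho) - m^2/(2 rho^2)) drho] plus
    the dissipation density is the space derivative of the flux
    [m (a m'/rho^2 - m^2/(2 rho^2) - P'(rho))].  At an inner vertex the coupling
    condition makes the second factor equal to [- h_v] on all incident edges, so
    that the boundary terms cancel by Kirchhoff's law; at a boundary vertex [m]
    vanishes.

    In time, the energy density [F] satisfies the exact identity
      [F(s, n) - F(r, m) - dF(r, m)(s - r, n - m)
         = (n - m s/r)^2/(2 s) + Bregman distance of P],
    whose right-hand side is quadratic in the increments: differentiability of
    [rho] in L^oo and of [m] in L^2 therefore suffices. *)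

(** [wderiv] and [cont_rep] are choices made by [get]: an equation in which they occur carries
    information only once some weak derivative, or some continuous representative, has been
    exhibited. The predicate [primitive] supplies them. On it the rules for products, reciprocals
    and powers all come from one chain rule in one variable, and the weak derivatives inside the
    momentum equation are thereby identified, up to null sets, with explicit square integrable
    densities.

    In time, the obstacle is that the difference quotient of [m] is close to [dm] in mean square
    only. The estimate therefore uses no pointwise bound on [m s], and it lets the error of this
    quotient enter squared. The one place where that error occurs to the first power is the linear
    part of the expansion, where its coefficient [m / r] is bounded at the fixed time [t]; Young's
    inequality turns it into a square divided by a small parameter [e], harmless because the mean
    square error is eventually below [e ^+ 2]. *)

Local Notation mu := lebesgue_measure.
Local Notation "\I_ ( a , b ) f" := (\int[mu]_(x in `[a, b]) f x)
  (at level 36, a at level 9, b at level 9, f at level 9).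
Local Notation integrable_on a b f := (mu.-integrable `[a, b] (EFin \o f)).
Local Notation continuous_on a b f := {within `[a, b], continuous f}.

(** * Almost everywhere statements, uniform continuity and negligible increments *)

Section Integration.
Context {R : realType}.
Implicit Types (a b x y l : R) (f g h u v : R -> R).

Lemma ae_imply (P Q : R -> Prop) : (forall x, P x -> Q x) ->
  (\forall x \ae mu, P x) -> \forall x \ae mu, Q x.
Proof. exact: (@filterS _ _ (ae_filter_ringOfSetsType mu) P Q). Qed.

Lemma ae_imply2 (P Q S : R -> Prop) : (forall x, P x -> Q x -> S x) ->
  (\forall x \ae mu, P x) -> (\forall x \ae mu, Q x) ->
  \forall x \ae mu, S x.
Proof. exact: (@filterS2 _ _ (ae_filter_ringOfSetsType mu) P Q S). Qed.

Lemma ae_and (P Q : R -> Prop) : (\forall x \ae mu, P x) ->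
  (\forall x \ae mu, Q x) -> \forall x \ae mu, P x /\ Q x.
Proof. by apply: ae_imply2 => x Px Qx. Qed.

Lemma integrable_onS a b x y f : a <= x -> y <= b ->
  integrable_on a b f -> integrable_on x y f.
Proof.
move=> ax yb; apply: integrableS => //.
by apply: subset_itvScc; rewrite bnd_simp.
Qed.

Lemma Rintegral_chasles a b x f : integrable_on a b f -> a <= x <= b ->
  \I_(a, b) f = \I_(a, x) f + \I_(x, b) f.
Proof.
move=> fi /andP[ax xb].
rewrite -(Rintegral_itv_obnd_cbnd (r := x)); last first.
  by apply: integrableS fi => //; apply: subset_itvScc; rewrite bnd_simp.
by rewrite -(@Rintegral_itvB _ f (BLeft a) (BRight b) x)// 1?addrC ?subrK.
Qed.

(** Heine's theorem. Compactness enters in its near-covering form: a radius that works near each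
    point yields one that works on the whole segment. *)
Lemma within_uniform_continuous a b f : {within `[a, b], continuous f} ->
  forall e : R, 0 < e -> exists2 d : R, 0 < d & forall x y,
    x \in `[a, b] -> y \in `[a, b] -> `|x - y| < d -> `|f x - f y| < e.
Proof.
move=> /subspace_continuousP cf e e0.
pose P (d : R) x := forall y, y \in `[a, b] -> `|x - y| < d -> `|f x - f y| < e.
have /compact_near_coveringP/near_covering_withinP cab := @segment_compact R a b.
have := cab R (0^'+) P _ => /(_ _ _)[].
  move=> x xab; have /cvgrPdist_lt/(_ (e / 2)) := cf x xab.
  rewrite divr_gt0// => /(_ isT)/nbhs_ballP[r /= r0 xr].
  (* Halving [r] keeps both [z] and every [y] within [d] of [z] inside the ball of radius [r] around
     [x], where [f] varies by less than [e / 2]. *)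
  exists (ball x (r / 2), [set d | d < r / 2]) => /=.
    by split; [exact/nbhsx_ballx/divr_gt0|exact/nbhs_right_lt/divr_gt0].
  move=> [z d] /= [xz dr] zab y yab zy.
  rewrite (_ : f z - f y = - (f x - f z) + (f x - f y)); last by ring.
  rewrite (le_lt_trans (ler_normD _ _))// [e]splitr normrN ltrD//.
    by apply: xr => //; apply: le_ball xz; lra.
  apply: xr => //; rewrite /ball/= in xz *.
  by rewrite -(subrKA z) (le_lt_trans (ler_normD _ _))//; lra.
move=> d /= d0 dP; exists (d / 2); first by rewrite divr_gt0.
move=> x y xab yab xy; apply: (dP (d / 2)) => //=; last by rewrite divr_gt0.
by rewrite sub0r normrN gtr0_norm; lra.
Qed.

Lemma itv_point_uniform a b (n i : nat) : (i <= n.+1)%N -> a <= b ->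
  a <= a + i%:R * ((b - a) / n.+1%:R) <= b.
Proof.
move=> ni ab; have n0 : (0 : R) < n.+1%:R by [].
rewrite lerDl mulr_ge0 ?divr_ge0 ?subr_ge0//= -lerBrDl mulrCA.
by rewrite ler_piMr ?subr_ge0// ler_pdivrMr// mul1r ler_nat.
Qed.

(* A function whose increments are negligible, locally uniformly, with respect
   to those of some [W] is constant: telescope over a fine subdivision. *)
Lemma increment_negligible a b (D W : R -> R) : a <= b ->
  (forall e : R, 0 < e -> exists2 d : R, 0 < d & forall x y,
     a <= x -> x <= y -> y <= b -> y - x < d ->
     `|D y - D x| <= e * (W y - W x)) ->
  D b = D a.
Proof.
move=> ab DW.
have DeW (e : R) : 0 < e -> `|D b - D a| <= e * (W b - W a).
  move=> e0; have [d d0 {}DW] := DW _ e0.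
  have [n nd] : exists n : nat, (b - a) / n.+1%:R < d.
    exists (Num.bound ((b - a) / d)); rewrite ltr_pdivrMr// mulrC -ltr_pdivrMr//.
    rewrite (lt_le_trans (archi_boundP _))// ?ler_nat//.
    by rewrite divr_ge0// ?subr_ge0// ltW.
  pose p (i : nat) := a + i%:R * ((b - a) / n.+1%:R).
  have pS i : p i.+1 - p i = (b - a) / n.+1%:R by rewrite /p -natr1; ring.
  suff H i : (i <= n.+1)%N -> `|D (p i) - D a| <= e * (W (p i) - W a).
    by have := H n.+1 (leqnn _); rewrite /p mulrC divfK ?pnatr_eq0// subrKC.
  elim: i => [_|i IH ni]; first by rewrite /p mul0r addr0 !subrr normr0 mulr0.
  rewrite -(subrKA (D (p i))) (le_trans (ler_normD _ _))//.
  rewrite -(subrKA (W (p i)) (W _)) mulrDr lerD ?IH ?(ltnW ni)// DW//.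
  - by case/andP: (itv_point_uniform (ltnW ni) ab).
  - by rewrite -subr_ge0 pS divr_ge0 ?subr_ge0.
  - by case/andP: (itv_point_uniform ni ab).
  - by rewrite pS.
apply/eqP; rewrite -subr_eq0 -normr_le0; apply/ler_addgt0Pr => e e0.
have W0 : 0 <= W b - W a by have := DeW 1 ltr01; rewrite mul1r; apply: le_trans.
(* The added 1 allows division even when [W] is constant. *)
have W1 : 0 < W b - W a + 1 by lra.
rewrite add0r (le_trans (DeW (e / (W b - W a + 1)) _))// ?divr_gt0//.
by rewrite mulrAC ler_pdivrMr// ler_pM2l//; lra.
Qed.

End Integration.

(** * Absolutely continuous functions on an interval and the chain rule *)

Section Primitive.
Context {R : realType}.
Implicit Types (a b x y l : R) (f g h U V : R -> R).

Lemma continuous_onP a b f : continuous_on a b f <->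
  forall x, x \in `[a, b] -> f z @[z --> within `[a, b] (nbhs x)] --> f x.
Proof. exact: subspace_continuousP. Qed.

Lemma continuous_on_integrable a b f :
  continuous_on a b f -> integrable_on a b f.
Proof. by move=> cf; apply: continuous_compact_integrable => //; exact:
  segment_compact. Qed.

Lemma continuous_on_measurable a b f :
  continuous_on a b f -> measurable_fun `[a, b] f.
Proof. by move=> /continuous_on_integrable/integrableP[/measurable_EFinP]. Qed.

Lemma continuous_on_bounded a b f : continuous_on a b f ->
  exists2 M : R, 0 < M & forall x, x \in `[a, b] -> `|f x| <= M.
Proof.
move=> cf; have /compact_bounded[M [_ Mf]] :=
  continuous_compact cf (@segment_compact _ a b).
exists (`|M| + 1) => [|x xab]; first by rewrite ltr_pwDr.
by apply: Mf; [rewrite (le_lt_trans (ler_norm _))// ltrDl|exists x].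
Qed.

Lemma integrable_on_bdM a b f g (M : R) : measurable_fun `[a, b] f ->
  (forall x, x \in `[a, b] -> `|f x| <= M) -> integrable_on a b g ->
  integrable_on a b (fun x => f x * g x).
Proof.
move=> mf Mf gi.
apply: (@integrableMr _ _ _ mu `[a, b]%classic _ f (EFin \o g)) => //.
exists M; split; first by rewrite num_real.
by move=> N MN x /= xab; rewrite (le_trans (Mf _ xab))// ltW.
Qed.

Lemma integrable_on_contM a b f g : continuous_on a b f ->
  integrable_on a b g -> integrable_on a b (fun x => f x * g x).
Proof.
move=> cf; have [M _ Mf] := continuous_on_bounded cf.
by apply: integrable_on_bdM Mf; exact: continuous_on_measurable.
Qed.

Lemma integrable_onD a b f g : integrable_on a b f -> integrable_on a b g ->
  integrable_on a b (fun x => f x + g x).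
Proof. by move=> fi gi; exact: (integrableD _ fi gi). Qed.

Lemma integrable_onB a b f g : integrable_on a b f -> integrable_on a b g ->
  integrable_on a b (fun x => f x - g x).
Proof. by move=> fi gi; exact: (integrableB _ fi gi). Qed.

Lemma integrable_onZ a b (k : R) f : integrable_on a b f ->
  integrable_on a b (fun x => k * f x).
Proof. by move=> fi; exact: (integrableZl _ k fi). Qed.

(** Absolute continuity of [U] with density [g], in integral form: no pointwise derivative appears,
    and [U] is fixed everywhere, end points included. *)
Definition primitive l U g : Prop := integrable_on 0 l g /\
  forall x, x \in `[0, l] -> U x = U 0 + \I_(0, x) g.

Lemma primitiveB_itv l U g x y : primitive l U g ->
  0 <= x -> x <= y -> y <= l -> U y - U x = \I_(x, y) g.
Proof.
move=> [gi Ug] x0 xy yl.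
rewrite (Ug x) ?(Ug y) ?in_itv/= ?x0 ?yl ?(le_trans x0 xy) ?(le_trans xy yl)//.
rewrite (@Rintegral_chasles _ 0 y x) ?x0 ?xy//; first by ring.
exact: integrable_onS gi.
Qed.

Lemma primitive_continuous l U g : 0 <= l -> primitive l U g ->
  continuous_on 0 l U.
Proof.
move=> l0 [gi Ug].
apply: (@subspace_eq_continuous _ _ _ (fun x => U 0 + \I_(0, x) g)) => /=.
  by move=> x xl; rewrite [RHS]Ug// -inE.
have /continuous_onP ci := parameterized_integral_continuous l0 gi.
apply/continuous_onP => x xl.
by apply: cvgD; [exact: cvg_cst|exact: ci].
Qed.

(* The point given by the mean value theorem for [F] between [U x] and [U y] is
   some [U w] with [w] between [x] and [y], by the intermediate value theorem:
   this is why continuity of [f \o U] is enough. *)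
Lemma primitive_comp l U g (F f : R -> R) : 0 <= l -> primitive l U g ->
  (forall x, x \in `[0, l] -> is_derive (U x) 1 F (f (U x))) ->
  continuous_on 0 l (f \o U) ->
  primitive l (F \o U) (fun x => f (U x) * g x).
Proof.
move=> l0 Ug dF cf; have [gi _] := Ug; have cU := primitive_continuous l0 Ug.
have fgi : integrable_on 0 l (fun x => f (U x) * g x).
  exact: (integrable_on_contM cf gi).
split => // z zl; have [z0 zl'] : 0 <= z /\ z <= l by move: zl; rewrite in_itv
  => /andP.
pose D x := F (U x) - \I_(0, x) (fun x => f (U x) * g x).
have D0 : D 0 = F (U 0) by rewrite /D set_itv1 Rintegral_set1 subr0.
apply/eqP; rewrite -subr_eq -[X in _ == X]D0; apply/eqP.
(* The increment of [D] over a short [[x, y]] will be the integral of [(f (U w) - f (U t)) * g t],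
   so uniform continuity of [f \o U] bounds it by [e] times the integral of [|g|]; hence this choice
   of [W]. *)
apply: (@increment_negligible _ 0 z D
  (fun x => \I_(0, x) (fun x => `|g x|))) => // e e0.
have [d d0 fd] := within_uniform_continuous cf e0.
exists d => // x y x0 xy yz yxd.
have yl : y <= l by exact: le_trans zl'.
have cUxy : continuous_on x y U.
  apply: continuous_subspaceW cU; apply: subset_itvScc; rewrite bnd_simp//.
have ngi : integrable_on 0 l (fun x => `|g x|) by exact: integrable_norm gi.
rewrite (@Rintegral_chasles _ 0 y x (fun x => `|g x|)) ?x0//; last exact:
  integrable_onS ngi.
rewrite /D (@Rintegral_chasles _ 0 y x (fun x => f (U x) * g x)) ?x0//; last
  exact: integrable_onS fgi.
rewrite [in leRHS]addrAC subrr add0r.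
have [w wxy FUw] : exists2 w, w \in `[x, y] & F (U y) - F (U x) = f (U w) * (U
  y - U x).
  pose p := Num.min (U x) (U y); pose q := Num.max (U x) (U y).
  have pqU v : v \in `[p, q] -> exists2 w, w \in `[x, y] & U w = v.
    by rewrite in_itv/=; exact: IVT.
  have dFv v : v \in `[p, q] -> is_derive v 1 F (f v).
    move=> /pqU[w]; rewrite in_itv/= => /andP[xw wy] <-.
    by apply: dF; rewrite in_itv/= (le_trans x0 xw) (le_trans wy yl).
  have pq : p <= q by rewrite /p /q; case: (leP (U x) (U y)) => // /ltW.
  have dFo v : v \in `]p, q[ -> is_derive v 1 F (f v).
    by move=> /subset_itv_oo_cc; exact: dFv.
  have cF : continuous_on p q F.
    apply: derivable_within_continuous => v vpq.
    by case: (dFv v vpq).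
  have [v vpq Fqp] := @MVT_segment R F f p q pq dFo cF.
  have [w wxy Uw] := pqU _ vpq; exists w => //; rewrite Uw.
  move: Fqp; rewrite /p /q; case: (leP (U x) (U y)) => // _ Fqp.
  by rewrite -[LHS]opprB Fqp; ring.
have xyl : forall v, v \in `[x, y] -> v \in `[0, l].
  by move=> v; rewrite !in_itv/= => /andP[xv vy]; rewrite (le_trans x0 xv)
    (le_trans vy yl).
have gixy : integrable_on x y g by exact: integrable_onS gi.
have fgixy : integrable_on x y (fun x => f (U x) * g x) by exact:
  integrable_onS fgi.
have ngixy : integrable_on x y (fun x => `|g x|) by exact: integrable_onS ngi.
have -> : F (U y) - (\I_(0, x) (fun x => f (U x) * g x) + \I_(x, y) (fun x => f
  (U x) * g x))
   - (F (U x) - \I_(0, x) (fun x => f (U x) * g x)) =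
   \I_(x, y) (fun t => f (U w) * g t - f (U t) * g t).
  rewrite RintegralB//; last exact: integrable_onZ.
  rewrite RintegralZl// -(primitiveB_itv Ug)// -FUw; ring.
rewrite -RintegralZl//.
have idiff : integrable_on x y (fun t => f (U w) * g t - f (U t) * g t).
  by apply: integrable_onB => //; exact: integrable_onZ.
apply: le_trans (le_normr_Rintegral _ idiff) _ => //.
apply: le_Rintegral => //; [exact: integrable_norm idiff|exact: integrable_onZ|].
move=> t txy; rewrite -mulrBl normrM ler_wpM2r// ltW// fd ?xyl//.
move: txy wxy; rewrite /= !in_itv/= => /andP[xt ty] /andP[xw wy].
by rewrite ltr_norml; apply/andP; split; lra.
Qed.

End Primitive.

(** * Sums, products, reciprocals and powers of absolutely continuous functions *)

Section PrimitiveAlgebra.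
Context {R : realType}.
Implicit Types (a b x y l : R) (f g h U V : R -> R).

Lemma eq_primitive l U V g : (forall x, x \in `[0, l] -> U x = V x) ->
  primitive l U g -> primitive l V g.
Proof.
move=> UV [gi Ug]; split => // x xl.
have l0 : 0 <= l by move: xl; rewrite in_itv/= => /andP[]; exact: le_trans.
have l00 : 0 \in `[0, l] by rewrite in_itv/= lexx.
by rewrite -(UV _ xl) -(UV _ l00); exact: Ug.
Qed.

Lemma eq_primitive_deriv l U g h : (forall x, x \in `[0, l] -> g x = h x) ->
  primitive l U g -> primitive l U h.
Proof.
move=> gh [gi Ug]; split => [|x xl].
  by apply: eq_integrable gi => // x /[!inE] xl; rewrite /= gh.
rewrite Ug//; congr (_ + _); apply: eq_Rintegral => z; rewrite inE => zx.
apply: gh; move: zx xl; rewrite /= !in_itv/= => /andP[-> zx] /andP[_ xl].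
exact: le_trans xl.
Qed.

Lemma primitive_cst l (k : R) : primitive l (fun=> k) (fun=> 0).
Proof.
split; first exact: integrable0.
by move=> x _; rewrite Rintegral_cst// mul0r addr0.
Qed.

Lemma primitive_id l : primitive l id (fun=> 1).
Proof.
split => [|x].
  apply: continuous_on_integrable; apply: continuous_subspaceT.
  by move=> x; exact: cvg_cst.
rewrite in_itv/= => /andP[x0 _].
rewrite Rintegral_cst// mul1r add0r.
transitivity (fine (mu `[0, x]%classic)) => //.
rewrite lebesgue_measure_itv/= lte_fin.
move: x0; rewrite le_eqVlt => /predU1P[<-|x0]; first by rewrite ltxx.
by rewrite x0/= oppr0 addr0.
Qed.

Lemma primitiveD l U V g h : primitive l U g -> primitive l V h ->
  primitive l (fun x => U x + V x) (fun x => g x + h x).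
Proof.
move=> [gi Ug] [hi Vh]; split => [|x xl]; first exact: integrable_onD.
rewrite Ug// Vh// RintegralD//; first by ring.
all: move: xl; rewrite in_itv/= => /andP[_ xl].
all: by [exact: integrable_onS gi|exact: integrable_onS hi].
Qed.

Lemma primitiveZ l (k : R) U g : primitive l U g ->
  primitive l (fun x => k * U x) (fun x => k * g x).
Proof.
move=> [gi Ug]; split => [|x xl]; first exact: integrable_onZ.
rewrite Ug// RintegralZl//; first by ring.
by move: xl; rewrite in_itv/= => /andP[_ xl]; exact: integrable_onS gi.
Qed.

Lemma primitive_sqr l U g : 0 <= l -> primitive l U g ->
  primitive l (fun x => U x ^+ 2) (fun x => 2 * U x * g x).
Proof.
move=> l0 Ug; apply: (@primitive_comp _ l U g (fun y => y ^+ 2) (fun y => 2 *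
  y)) => //.
  move=> x _; have -> : (fun y : R => y ^+ 2) = id ^+ 2 by apply/funext.
  apply: is_derive_eq.
  by rewrite /= expr1 /GRing.scale/= mulr1.
apply: (@primitive_continuous _ _ _ (fun x => 2 * g x)) => //.
exact: primitiveZ.
Qed.

Lemma primitiveM l U V g h : 0 <= l -> primitive l U g -> primitive l V h ->
  primitive l (fun x => U x * V x) (fun x => g x * V x + U x * h x).
Proof.
move=> l0 Ug Vh.
(* polarization *)
have sD := primitive_sqr l0 (primitiveD Ug Vh).
have sB := primitive_sqr l0 (primitiveD Ug (primitiveZ (-1) Vh)).
have := primitiveD (primitiveZ (4^-1) sD) (primitiveZ (- 4^-1) sB).
congr (primitive l _ _); apply/funext => x; lra.
Qed.

Lemma primitiveV l U g : 0 <= l -> primitive l U g ->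
  (forall x, x \in `[0, l] -> U x != 0) ->
  primitive l (fun x => (U x)^-1) (fun x => - (U x)^-1 ^+ 2 * g x).
Proof.
move=> l0 Ug U0.
apply: (@primitive_comp _ l U g GRing.inv (fun y => - y^-1 ^+ 2)) => //.
  move=> x xl; have := @is_deriveV _ id (U x) 1 1 (U0 _ xl) (is_derive_id _ _).
  move=> dV; apply: is_derive_eq.
  by rewrite /GRing.scale/= mulr1 exprVn.
have /continuous_onP cU := primitive_continuous l0 Ug.
apply/continuous_onP => x xl; apply: cvgN.
by apply: cvgM; apply: cvgV; [exact: U0|exact: cU|exact: U0|exact: cU].
Qed.

Lemma powR_continuous_pos (p y : R) : 0 < y -> {for y, continuous (fun z => z
  `^ p)}.
Proof.
move=> y0; apply: differentiable_continuous; apply/derivable1_diffP.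
by case: (is_derive1_powR p y0).
Qed.

Lemma primitive_powR l U g (p : R) : 0 <= l -> primitive l U g ->
  (forall x, x \in `[0, l] -> 0 < U x) ->
  primitive l (fun x => U x `^ p) (fun x => p * U x `^ (p - 1) * g x).
Proof.
move=> l0 Ug U0.
apply: (@primitive_comp _ l U g (fun y => y `^ p) (fun y => p * y `^ (p - 1)))
  => //.
  by move=> x xl; apply: is_derive1_powR; exact: U0.
have /continuous_onP cU := primitive_continuous l0 Ug.
apply/continuous_onP => x xl; apply: cvgM; first exact: cvg_cst.
have cp := @powR_continuous_pos (p - 1) _ (U0 _ xl).
by have := cvg_comp _ _ (cU _ xl) cp.
Qed.

End PrimitiveAlgebra.

(** * Square integrability without extended-real norms *)

Section SquareIntegrable.
Context {R : realType}.
Implicit Types (a b x y l : R) (f g h U V u : R -> R).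

Definition square_integrable l g : Prop :=
  measurable_fun `[0, l] g /\ integrable_on 0 l (fun x => g x ^+ 2).

Lemma in_L2P l g : in_Lp 2%:E l g <-> square_integrable l g.
Proof.
apply: (@iff_trans _ (measurable_fun setT (zext l g) /\
    (\int[mu]_x `|(zext l g x)%:E| `^ 2 < +oo)%E)).
  have N2 : ('N[mu]_2%:E[EFin \o zext l g] `^ 2 = \int[mu]_x `|(zext l g x)%:E|
    `^ 2)%E.
    by rewrite poweR_Lnorm ?pnatr_eq0.
  rewrite -N2; split.
    by move=> /andP[/[!inE] mg gy]; split => //; exact: poweR_lty.
  move=> [mg gy]; apply/andP; rewrite !inE; split => //.
  by apply: lty_poweRy gy; rewrite pnatr_eq0.
have -> : (\int[mu]_x `|(zext l g x)%:E| `^ 2 =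
    \int[mu]_(x in `[0%R, l]) `|((g x) ^+ 2)%:E|)%E.
  rewrite [RHS]integral_mkcond; apply: eq_integral => x _.
  rewrite /zext !patchE; case: ifP => // _.
    by rewrite /= powR_mulrn// -normrX.
  by rewrite /= normr0  powR0 ?pnatr_eq0.
split=> -[mg gi].
  have {}mg : measurable_fun `[0, l] g by apply/(measurable_restrictT _ _).2.
  split => //; apply/integrableP; split => //.
  by apply/measurable_EFinP; exact: measurable_funX.
split; first by apply/(measurable_restrictT _ _).1.
by case/integrableP: gi.
Qed.

End SquareIntegrable.

(** * From primitives to weak derivatives *)

Section WeakDerivative.
Context {R : realType}.
Implicit Types (a b x y l : R) (f g h U V u phi : R -> R).

Lemma square_integrable_integrable l g :
  square_integrable l g -> integrable_on 0 l g.
Proof.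
move=> [mg gi].
apply: (@le_integrable _ _ _ mu `[0, l]%classic _ _ (EFin \o (fun x => 1 + g x
  ^+ 2))) => //.
- exact/measurable_EFinP.
- move=> x _ /=; rewrite lee_fin [leRHS]ger0_norm ?addr_ge0 ?sqr_ge0//.
  rewrite -real_normK ?num_real//.
  have := sqr_ge0 (`|g x| - 1); nra.
- apply: integrable_onD => //; apply: continuous_on_integrable.
  by apply: continuous_subspaceT => x; exact: cvg_cst.
Qed.

Lemma square_integrableD l g h : square_integrable l g ->
  square_integrable l h -> square_integrable l (fun x => g x + h x).
Proof.
move=> [mg gi] [mh hi]; have mgh := measurable_funD mg mh; split => //.
apply: (@le_integrable _ _ _ mu `[0, l]%classic _ _
  (EFin \o (fun x => 2 * g x ^+ 2 + 2 * h x ^+ 2))) => //.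
- by apply/measurable_EFinP; exact: measurable_funX.
- move=> x _ /=; rewrite lee_fin !ger0_norm ?sqr_ge0//; last first.
    by have := sqr_ge0 (g x); have := sqr_ge0 (h x); nra.
  have := sqr_ge0 (g x - h x); nra.
- exact: (integrable_onD (integrable_onZ 2 gi) (integrable_onZ 2 hi)).
Qed.

Lemma square_integrable_contM l f g : continuous_on 0 l f ->
  square_integrable l g -> square_integrable l (fun x => f x * g x).
Proof.
move=> cf [mg gi]; have mf := continuous_on_measurable cf; split.
  exact: measurable_funM.
rewrite (_ : (fun _ => _) = (fun x => f x ^+ 2 * g x ^+ 2)); last first.
  by apply/funext => x; rewrite exprMn.
have [M _ fM] := continuous_on_bounded cf.
apply: (@integrable_on_bdM _ _ _ _ _ (M ^+ 2)) => //.
  exact: measurable_funX.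
by move=> x xl; rewrite normrX lerXn2r ?nnegrE// ?(le_trans _ (fM _ xl))// fM.
Qed.

Lemma square_integrable_continuous l f : continuous_on 0 l f ->
  square_integrable l f.
Proof.
move=> cf; have := @square_integrable_contM l f (fun=> 1) cf.
rewrite (_ : (fun x => f x * 1) = f); last by apply/funext => x; rewrite mulr1.
apply; split => //; rewrite (_ : (fun _ => _) = cst 1); last first.
  by apply/funext => x; rewrite expr1n.
apply: continuous_on_integrable.
by apply: continuous_subspaceT => x; exact: cvg_cst.
Qed.

Lemma ae_eq_Rintegral a b f g :
  measurable_fun `[a, b] f -> measurable_fun `[a, b] g ->
  (\forall x \ae mu, x \in `[a, b] -> f x = g x) -> \I_(a, b) f = \I_(a, b) g.
Proof.
move=> mf mg fg; rewrite /Rintegral; congr fine; apply: ae_eq_integral => //.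
- exact/measurable_EFinP.
- exact/measurable_EFinP.
- apply: ae_imply fg => x xfg xab; rewrite /= xfg//.
Qed.

Lemma test_fun_primitive l phi : 0 <= l -> test_fun l phi ->
  primitive l phi (phi^`())%classic.
Proof.
move=> l0 [dphi cphi _ _].
(* Composing with the identity turns the chain rule into the fundamental theorem of calculus for a
   function of class C^1. *)
have := @primitive_comp _ l id (fun=> 1) phi (phi^`())%classic l0 (primitive_id l).
rewrite (_ : (fun x => _ * 1) = (phi^`())%classic); last first.
  by apply/funext => x; rewrite mulr1.
apply; first by move=> x _; split => //; rewrite derive1E.
exact: continuous_subspaceT.
Qed.

Lemma test_fun_out l phi x : test_fun l phi -> x \notin `]0, l[ -> phi x = 0.
Proof.
move=> [_ _ _ sphi]; apply: contraNeq => phix.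
by apply: sphi; apply: subset_closure.
Qed.

(** Integration by parts: the product rule for [U] and the test function is integrated over
    [[0, l]], and the boundary terms vanish with the test function. *)
Lemma is_weak_deriv_primitive l U g u : 0 <= l -> primitive l U g ->
  square_integrable l g -> measurable_fun `[0, l] u ->
  (\forall x \ae mu, x \in `[0, l] -> u x = U x) ->
  is_weak_deriv l u g.
Proof.
move=> l0 Ug g2 mu_ uU; split; first exact/in_L2P.
move=> phi tphi; have phi_prim := test_fun_primitive l0 tphi.
have [dphi cphi _ _] := tphi.
have cdphi : continuous_on 0 l (phi^`())%classic by exact: continuous_subspaceT.
have cU := primitive_continuous l0 Ug.
have cp := primitive_continuous l0 phi_prim.
rewrite (@ae_eq_Rintegral _ _ (fun x => u x * _) (fun x => U x *
  (phi^`())%classic x)); last 3 first.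
- by apply: measurable_funM => //; exact: continuous_on_measurable.
- by apply: measurable_funM; exact: continuous_on_measurable.
- apply: ae_imply uU => x ux xl; rewrite ux//.
have gi := square_integrable_integrable g2.
have [pi /(_ l)] := primitiveM l0 Ug phi_prim.
rewrite in_itv/= l0 lexx => /(_ isT).
rewrite !(@test_fun_out l phi _ tphi) ?in_itv/= ?ltxx ?andbF// !mulr0 add0r.
rewrite RintegralD//; last 2 first.
- rewrite (_ : (fun _ => _) = (fun x => phi x * g x)).
    exact: integrable_on_contM.
  by apply/funext => x; rewrite mulrC.
- by apply: integrable_on_contM => //; exact: continuous_on_integrable.
by move=> /esym/eqP; rewrite addrC addr_eq0 => /eqP.
Qed.

End WeakDerivative.

(** * The lemma of du Bois-Reymond *)

Section DuBoisReymond.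
Context {R : realType}.
Implicit Types (a b x y l : R) (f g h u v w phi psi : R -> R) (k n : nat).

Lemma continuous_max f g : continuous f -> continuous g ->
  continuous (fun x => Num.max (f x) (g x)).
Proof.
move=> cf cg.
rewrite (_ : (fun _ => _) = fun x => (f x + g x + `|f x - g x|) / 2); last first.
  by apply/funext => x; rewrite maxr_absE.
move=> x; apply: cvgM; last exact: cvg_cst.
 apply: cvgD; first by apply: cvgD; [exact: cf|exact: cg].
by apply: cvg_norm; apply: cvgB; [exact: cf|exact: cg].
Qed.

Lemma continuous_min f g : continuous f -> continuous g ->
  continuous (fun x => Num.min (f x) (g x)).
Proof.
move=> cf cg.
rewrite (_ : (fun _ => _) = fun x => (f x + g x - `|f x - g x|) / 2); last first.
  by apply/funext => x; rewrite minr_absE.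
move=> x; apply: cvgM; last exact: cvg_cst.
 apply: cvgB; first by apply: cvgD; [exact: cf|exact: cg].
by apply: cvg_norm; apply: cvgB; [exact: cf|exact: cg].
Qed.

(** A continuous approximation of the indicator of []0, y[]. Subtracting 1 makes it vanish up to
    distance [1 / (n + 1)] from the ends, so that its support is compact in the open interval; for
    large [n] the plateau starts at distance [2 / (n + 1)]. *)
Definition trapezoid y n x : R :=
  Num.max 0 (Num.min 1 (Num.min (n.+1%:R * x - 1) (n.+1%:R * (y - x) - 1))).

Lemma trapezoid_continuous y n : continuous (trapezoid y n).
Proof.
apply: continuous_max => [x|]; first exact: cvg_cst.
apply: continuous_min => [x|]; first exact: cvg_cst.
apply: continuous_min => x; (apply: cvgB; last exact: cvg_cst);
  (apply: cvgM; first exact: cvg_cst); first exact: cvg_id.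
by apply: cvgB; [exact: cvg_cst|exact: cvg_id].
Qed.

Lemma trapezoid_bound y n x : 0 <= trapezoid y n x <= 1.
Proof. by rewrite /trapezoid le_max lexx ge_max ler01 ge_min lexx. Qed.

Lemma trapezoid_eq0 y n x : x <= n.+1%:R^-1 \/ y - n.+1%:R^-1 <= x ->
  trapezoid y n x = 0.
Proof.
have n0 : (0 : R) < n.+1%:R by [].
move=> xny; apply/max_idPl; rewrite !ge_min !subr_le0 !(mulrC n.+1%:R).
rewrite -!ler_pdivlMr// !mul1r.
by case: xny => [->|]; rewrite ?orbT// lerBlDl addrC -lerBlDl => ->; rewrite !orbT.
Qed.

Lemma trapezoid_cvg y x : 0 < x < y ->
  trapezoid y n x @[n --> \oo] --> (1 : R).
Proof.
move=> /andP[x0 xy]; apply: cvg_near_cst; near=> n.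
have xn : 2 <= n.+1%:R * x.
  rewrite -ler_pdivrMr// (le_trans (y := n%:R)) ?ler_nat//.
  by near: n; exact: nbhs_infty_ger.
have yn : 2 <= n.+1%:R * (y - x).
  rewrite -ler_pdivrMr ?subr_gt0// (le_trans (y := n%:R)) ?ler_nat//.
  by near: n; exact: nbhs_infty_ger.
rewrite /trapezoid.
rewrite (@min_l _ _ 1); last by rewrite le_min; apply/andP; split; lra.
exact/max_idPr.
Unshelve. all: by end_near. Qed.

(** The zero mean makes the antiderivative return to 0 on the right of the support of [psi]. *)
Lemma test_fun_antiderivative l psi (d : R) : 0 <= l -> 0 < d ->
  continuous psi -> (forall x, x <= d \/ l - d <= x -> psi x = 0) ->
  \I_(0, l) psi = 0 ->
  exists2 phi, test_fun l phi & (phi^`())%classic = psi.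
Proof.
move=> l0 d0 cpsi psi0 psiI.
(* Integrating from [-oo] defines [phi] on the whole line, where a test function has to be
   differentiable. *)
pose phi x := \int[mu]_(t in `]-oo, x]) psi t.
have psiE : psi \_ `[0, l] = psi.
  apply/funext => x; rewrite patchE; case: ifPn => //.
  rewrite notin_setE/= in_itv/= => /negP; rewrite negb_and -!ltNge => xl.
  by rewrite psi0//; case/orP: xl => xl; [left|right]; lra.
have ipsiT : mu.-integrable setT (EFin \o psi).
  rewrite -psiE -restrict_EFin; apply/(integrable_mkcond _ _).1 => //.
  by apply: continuous_on_integrable; exact: continuous_subspaceT.
have ipsi y : mu.-integrable `]-oo, y] (EFin \o psi) by exact: integrableS ipsiT.
have dphi x : derivable phi x 1 /\ (phi^`())%classic x = psi x.
  apply: (@continuous_FTC1 _ psi -oo%O x (x + 1)) => //; first by rewrite ltrDl.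
  by rewrite ltNyr.
  exact: cpsi.
have phi0 x : x \notin `[d, l - d] -> phi x = 0.
  rewrite in_itv/= negb_and -!ltNge /phi Rintegral_mkcond => xld.
  have [xd|xd] := leP x d.
    rewrite (_ : _ \_ _ = cst 0) ?Rintegral_cst ?mul0r//.
    apply/funext => z; rewrite patchE; case: ifPn => //.
    rewrite inE/= in_itv/= => zx; apply: psi0; left; exact: le_trans xd.
  rewrite (_ : _ \_ _ = psi \_ `[0, l]); first by rewrite -Rintegral_mkcond.
  rewrite psiE; apply/funext => z; rewrite patchE; case: ifPn => //.
  rewrite notin_setE/= in_itv/= => /negP; rewrite -ltNge => xz.
  by rewrite psi0//; right; case/orP: xld => ?; lra.
have sphi : closure [set x | phi x != 0] `<=` `[d, l - d].
  move=> x xphi; have : closure `[d, l - d] x.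
    by apply: closure_subset xphi => z /=; apply: contraNT => /phi0 ->.
  exact: interval_closed.
exists phi; last by apply/funext => x; case: (dphi x).
split.
- by move=> x; case: (dphi x).
- by rewrite (_ : (phi^`())%classic = psi)//; apply/funext => x; case: (dphi x).
- apply: (@subclosed_compact _ _ `[d, l - d]%classic) => //.
    exact: closed_closure.
  exact: segment_compact.
- by move=> x /sphi/=; rewrite !in_itv/= => /andP[dx xl]; apply/andP; split; lra.
Qed.

(** Dominated convergence with bound [|v|]; the limit is [v] restricted to the open interval, which
    differs from the closed one by a null set. *)
Lemma Rintegral_trapezoid_cvg l y v : 0 < y <= l -> integrable_on 0 l v ->
  \I_(0, l) (fun x => v x * trapezoid y n x) @[n --> \oo] --> \I_(0, y) v.
Proof.
move=> /andP[y0 yl] vi.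
have mv : measurable_fun `[0, l] v by case/integrableP : vi => /measurable_EFinP.
have vtrap x : trapezoid y n x * v x @[n --> \oo] --> (v \_ `]0, y[) x.
  rewrite patchE; case: ifPn => [|xy].
    rewrite inE/= in_itv/= => xy; rewrite -[X in _ --> X]mul1r.
    by apply: cvgM; [exact: trapezoid_cvg|exact: cvg_cst].
  apply: cvg_near_cst; apply: nearW => n; rewrite trapezoid_eq0 ?mul0r//.
  have n0 : (0 : R) < n.+1%:R^-1 by rewrite invr_gt0.
  move: xy; rewrite notin_setE/= in_itv/= => /negP; rewrite negb_and -!leNgt.
  move: n.+1%:R^-1 n0 => d d0.
  by case/orP => ?; [left|right]; lra.
have -> : \I_(0, y) v = \I_(0, l) (v \_ `]0, y[).
  rewrite -Rintegral_mkcondr setIidr; last first.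
    by apply: subset_itvScc; rewrite bnd_simp.
  rewrite /Rintegral integral_itv_bndoo//.
  apply/measurable_EFinP; apply: measurable_funS mv => //.
  by apply: subset_itvScc; rewrite bnd_simp.
have tcont n : continuous_on 0 l (trapezoid y n).
  by apply: continuous_subspaceT; exact: trapezoid_continuous.
have [] := @dominated_convergence _ _ _ mu `[0, l]%classic _
  (fun n x => (trapezoid y n x * v x)%:E) (EFin \o (v \_ `]0, y[))
  (fun x => `|v x|%:E).
- by [].
- move=> n; apply/measurable_EFinP; apply: measurable_funM => //.
  exact: continuous_on_measurable.
- apply/measurable_EFinP/measurable_restrict => //.
  by apply: measurable_funS mv.
- by apply: aeW => x _; apply/cvg_EFin; [exact: nearW|exact: vtrap].
- exact: integrable_norm.
- apply: aeW => x n _; rewrite /= lee_fin normrM ler_piMl//.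
  by case/andP: (trapezoid_bound y n x) => t0 t1; rewrite ger0_norm.
move=> vyi _; rewrite -(fineK (integrable_fin_num _ vyi))//.
move=> /fine_cvgP [_]; apply: cvg_trans; apply: near_eq_cvg.
by apply: nearW => n /=; congr fine; apply: eq_integral => x _; rewrite /= mulrC.
Qed.

(** By Lebesgue differentiation, [v] is almost everywhere the derivative of its own integral. The
    extension by zero serves to integrate from [-oo]. *)
Lemma ae_eq0_Rintegral l v : integrable_on 0 l v ->
  (forall y, 0 < y <= l -> \I_(0, y) v = 0) ->
  \forall x \ae mu, x \in `[0, l] -> v x = 0.
Proof.
move=> vi v0.
have ivT : mu.-integrable setT (EFin \o (v \_ `[0, l])).
  by rewrite -restrict_EFin; apply/(integrable_mkcond _ _).1.
have ivS y : mu.-integrable `]-oo, y] (EFin \o (v \_ `[0, l])).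
  exact: integrableS ivT.
have := FTC1Ny ivS (integrable_locally _ vi) => /(_ (measurable_itv _)).
rewrite (_ : (fun x => _) = cst 0); last first.
  apply/funext => y; rewrite -Rintegral_mkcondr.
  have -> : `]-oo, y] `&` `[0, l] = `[0, Num.min y l]%classic.
    apply/seteqP; split => x /=; rewrite !in_itv/= le_min.
      by move=> [-> /andP[-> ->]].
    by move=> /and3P[-> -> ->].
  have [ly0|] := ltP 0 (Num.min y l); first by apply: v0; rewrite ly0 ge_min
    lexx orbT.
  rewrite le_eqVlt => /predU1P[->|ly0]; first by rewrite set_itv1 Rintegral_set1.
  by rewrite set_itv_ge ?Rintegral_set0// bnd_simp -ltNge.
apply: ae_imply => x [_ +] xl; rewrite patchE mem_set// => <-.
exact: derive1_cst.
Qed.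

(** The integral of [w] against a trapezoid is proportional to the integral of the trapezoid, with a
    ratio [k] common to all of them; letting the trapezoids fill []0, y[] shows that [w - k] has
    integral 0 over every [[0, y]]. *)
Lemma du_bois_reymond l w : 0 < l -> integrable_on 0 l w ->
  (forall phi, test_fun l phi -> \I_(0, l) (fun x => w x * (phi^`())%classic x)
    = 0) ->
  exists k : R, \forall x \ae mu, x \in `[0, l] -> w x = k.
Proof.
move=> l0 wi wphi.
have i1 : integrable_on 0 l (cst 1).
  apply: continuous_on_integrable; apply: continuous_subspaceT => x; exact: cvg_cst.
have tcont y n : continuous_on 0 l (trapezoid y n).
  by apply: continuous_subspaceT; exact: trapezoid_continuous.
have ti y n : integrable_on 0 l (trapezoid y n) by exact: continuous_on_integrable.
(* The limit is positive, so some trapezoid has nonzero integral and can serve to normalise the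
   others. *)
have lim1 : \I_(0, l) (fun x => 1 * trapezoid l n x) @[n --> \oo] --> l.
  have := @Rintegral_trapezoid_cvg l l (cst 1) _ i1.
  rewrite l0 lexx => /(_ isT).
  by have [_ /(_ l)] := primitive_id l; rewrite in_itv/= lexx ltW// add0r =>
    /(_ isT) <-.
(* Subtracting from a trapezoid a multiple of [trapezoid l N] makes its integral
   vanish, and hence makes it the derivative of a test function. *)
have [N tN] : exists N, \I_(0, l) (trapezoid l N) != 0.
  apply: contrapT => /forallNP t0.
  suff : l = 0 by move=> ll0; rewrite ll0 ltxx in l0.
  have := cvg_lim _ lim1 => <-//; apply/cvg_lim => //; apply: cvg_near_cst.
  apply: nearW => n; have /negP := t0 n; rewrite negbK => /eqP t0n.
  by under eq_Rintegral do rewrite mul1r.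
pose k := \I_(0, l) (fun x => w x * trapezoid l N x) / \I_(0, l) (trapezoid l N).
have wtr y n : integrable_on 0 l (fun x => w x * trapezoid y n x).
  rewrite (_ : (fun _ => _) = (fun x => trapezoid y n x * w x)).
    exact: integrable_on_contM.
  by apply/funext => x; rewrite mulrC.
have wk y n : 0 < y <= l ->
  \I_(0, l) (fun x => w x * trapezoid y n x) = k * \I_(0, l) (trapezoid y n).
  move=> /andP[y0 yl].
  pose r := \I_(0, l) (trapezoid y n) / \I_(0, l) (trapezoid l N).
  pose d : R := Num.min n.+1%:R^-1 N.+1%:R^-1.
  have d0 : 0 < d by rewrite lt_min !invr_gt0 !ltr0n.
  pose eta x := trapezoid y n x - r * trapezoid l N x.
  have ceta : continuous eta.
    move=> x; apply: cvgB; first exact: trapezoid_continuous.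
    by apply: cvgM; [exact: cvg_cst|exact: trapezoid_continuous].
  have eta0 x : x <= d \/ l - d <= x -> eta x = 0.
    have dn : d <= n.+1%:R^-1 by rewrite ge_min lexx.
    have dN : d <= N.+1%:R^-1 by rewrite ge_min lexx orbT.
    move: dn dN; rewrite /eta; move: d d0 => d d0 dn dN xd.
    rewrite !trapezoid_eq0 ?mulr0 ?subrr//.
      case: xd => xd; [left; exact: le_trans dN|right; apply: le_trans xd].
      by rewrite lerD2l lerN2.
    case: xd => xd; [left; exact: le_trans dn|right].
    by rewrite (le_trans (y := l - d))// lerD// lerN2.
  have etaI : \I_(0, l) eta = 0.
    rewrite RintegralB//; last exact: integrable_onZ.
    by rewrite RintegralZl// divfK// subrr.
  have [phi tphi phiE] := test_fun_antiderivative (ltW l0) d0 ceta eta0 etaI.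
  have := wphi _ tphi; rewrite phiE.
  under eq_Rintegral do rewrite /eta mulrBr mulrCA.
  rewrite RintegralB//; last exact: integrable_onZ.
  rewrite RintegralZl// => /eqP; rewrite subr_eq0 => /eqP ->.
  by rewrite /k /r; ring.
exists k; have vi : integrable_on 0 l (fun x => w x - k).
  apply: integrable_onB => //; apply: continuous_on_integrable.
  by apply: continuous_subspaceT => x; exact: cvg_cst.
have := @ae_eq0_Rintegral l _ vi.
have vy y : 0 < y <= l -> \I_(0, y) (fun x => w x - k) = 0.
  move=> y0l; have tv := Rintegral_trapezoid_cvg y0l vi.
  rewrite -(cvg_lim _ tv)//; apply/cvg_lim => //; apply: cvg_near_cst.
  apply: nearW => n.
  under eq_Rintegral do rewrite mulrBl.
  rewrite RintegralB//; last exact: integrable_onZ.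
  by rewrite RintegralZl// wk// subrr.
move=> /(_ vy); apply: ae_imply => x xv xl; apply/eqP; rewrite -subr_eq0.
by apply/eqP; exact: xv.
Qed.

End DuBoisReymond.

(** * Continuous representatives and uniqueness of weak derivatives *)

Section Representative.
Context {R : realType}.
Implicit Types (a b x y l : R) (f g h u v w U V : R -> R).

(** By continuity, a disagreement at one point would persist on an open interval, which has positive
    measure. *)
Lemma continuous_on_ae_eq l U V : 0 < l ->
  continuous_on 0 l U -> continuous_on 0 l V ->
  (\forall x \ae mu, x \in `[0, l] -> U x = V x) ->
  forall x, x \in `[0, l] -> U x = V x.
Proof.
move=> l0 /continuous_onP cU /continuous_onP cV [N [mN N0 UVN]] x xl.
apply/eqP; rewrite -subr_eq0; apply/negPn/negP => UVx.
have : (U z - V z) @[z --> within `[0, l] (nbhs x)] --> U x - V x.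
  by apply: cvgB; [exact: cU|exact: cV].
move=> /cvgrPdist_lt/(_ `|U x - V x|).
rewrite normr_gt0 => /(_ UVx)/nbhs_ballP[d /= d0 dUV].
move: (xl); rewrite in_itv/= => /andP[x0 xl'].
(* Clipping to [[0, l]] leaves a nondegenerate interval even when [x] is an end point, because
   [0 < l]. *)
pose p := Num.max 0 (x - d); pose q := Num.min l (x + d).
have pq : p < q by rewrite gt_max !lt_min; apply/andP; split; apply/andP;
  split; lra.
have pqN : `]p, q[ `<=` N.
  move=> z/=; rewrite in_itv/= gt_max lt_min => /andP[/andP[z0 zgt] /andP[zl zlt]].
  have zl0 : z \in `[0, l] by rewrite in_itv/= !ltW.
  apply: UVN => /(_ zl0) UVz.
  have xz : ball x d z by rewrite /ball/= ltr_norml; apply/andP; split; lra.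
  by have := dUV z xz zl0; rewrite /= UVz subrr subr0 ltxx.
have : (mu `]p, q[%classic <= mu N)%E by apply: le_measure; rewrite ?inE.
by rewrite N0 lebesgue_measure_itv/= lte_fin pq -EFinB lee_fin leNgt subr_gt0 pq.
Qed.

Lemma in_L2_integrable l u : in_Lp 2%:E l u -> integrable_on 0 l u.
Proof. by move=> /in_L2P; exact: square_integrable_integrable. Qed.

Lemma primitive_Rintegral l g : integrable_on 0 l g ->
  primitive l (fun x => \I_(0, x) g) g.
Proof. by move=> gi; split => // x _; rewrite set_itv1 Rintegral_set1 add0r. Qed.

(** The integral [G] of [g] also has weak derivative [g], so [u - G] annihilates all derivatives of
    test functions and is a constant. *)
Lemma weak_deriv_primitive l u g : 0 < l -> integrable_on 0 l u ->
  is_weak_deriv l u g ->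
  exists2 U, primitive l U g & \forall x \ae mu, x \in `[0, l] -> u x = U x.
Proof.
move=> l0 ui [/in_L2P g2 ug]; have gi := square_integrable_integrable g2.
have Gg := primitive_Rintegral gi; set G := fun x => _ in Gg.
have cG := primitive_continuous (ltW l0) Gg.
have Gi := continuous_on_integrable cG.
have GG : \forall x \ae mu, x \in `[0, l] -> G x = G x by exact: aeW.
have [_ Gwg] := is_weak_deriv_primitive (ltW l0) Gg g2
  (continuous_on_measurable cG) GG.
have [||k uGk] := @du_bois_reymond _ l (fun x => u x - G x) l0.
- exact: integrable_onB.
- move=> phi tphi.
  have cphi : continuous_on 0 l (phi^`())%classic.
    by case: tphi => _ + _ _; exact: continuous_subspaceT.
  have phii v : integrable_on 0 l v ->
      integrable_on 0 l (fun x => v x * (phi^`())%classic x).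
    rewrite (_ : (fun x => v x * _) = fun x => (phi^`())%classic x * v x).
      exact: integrable_on_contM.
    by apply/funext => x; rewrite mulrC.
  under eq_Rintegral do rewrite mulrBl.
  by rewrite RintegralB ?ug ?Gwg ?subrr//; exact: phii.
exists (fun x => G x + k).
  have := primitiveD Gg (primitive_cst l k).
  by congr (primitive _ _ _); apply/funext => x; rewrite addr0.
by apply: ae_imply uGk => x uGx xl; rewrite -(uGx xl) subrKC.
Qed.

Lemma weak_deriv_unique l u g h : 0 < l -> integrable_on 0 l u ->
  is_weak_deriv l u g -> is_weak_deriv l u h ->
  \forall x \ae mu, x \in `[0, l] -> g x = h x.
Proof.
move=> l0 ui ug uh.
have [U [gi Ug] uU] := weak_deriv_primitive l0 ui ug.
have [V [hi Vh] uV] := weak_deriv_primitive l0 ui uh.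
have UV := @continuous_on_ae_eq l U V l0
  (primitive_continuous (ltW l0) (conj gi Ug)) (primitive_continuous (ltW l0)
    (conj hi Vh)).
have {}UV : forall x, x \in `[0, l] -> U x = V x.
  by apply: UV; apply: ae_imply2 uU uV => x ux vx xl; rewrite -ux// vx.
have := @ae_eq0_Rintegral _ l (fun x => g x - h x) (integrable_onB gi hi).
have gh0 y : 0 < y <= l -> \I_(0, y) (fun x => g x - h x) = 0.
  move=> /andP[y0 yl]; have yl' : y \in `[0, l] by rewrite in_itv/= ltW.
  have l00 : 0 \in `[0, l] by rewrite in_itv/= lexx ltW.
  rewrite RintegralB//; [|exact: integrable_onS gi|exact: integrable_onS hi].
  have := Vh _ yl'; rewrite -!UV// (Ug _ yl') => /addrI ->.
  by rewrite subrr.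
move=> /(_ gh0); apply: ae_imply => x + xl => /(_ xl)/eqP.
by rewrite subr_eq0 => /eqP.
Qed.

Lemma wderivP l u : in_H1 l u -> is_weak_deriv l u (wderiv l u).
Proof. by move=> [_ [g ug]]; rewrite /wderiv; apply: (@getPex _ [set g |
  is_weak_deriv l u g]); exists g. Qed.

Lemma wderiv_ae_eq l u g : 0 < l -> integrable_on 0 l u -> is_weak_deriv l u g ->
  \forall x \ae mu, x \in `[0, l] -> wderiv l u x = g x.
Proof.
move=> l0 ui ug; apply: (weak_deriv_unique l0 ui) => //.
by rewrite /wderiv; apply: (@getPex _ [set g | is_weak_deriv l u g]); exists g.
Qed.

Lemma cont_repE l u U : 0 < l -> continuous_on 0 l U ->
  (\forall x \ae mu, x \in `[0, l] -> u x = U x) ->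
  forall x, x \in `[0, l] -> cont_rep l u x = U x.
Proof.
move=> l0 cU uU; rewrite /cont_rep; set P := (X in get X).
have [|cW Wu] := @getPex _ P.
  by exists U; split => //; apply: ae_imply uU => x ux xl; rewrite ux.
apply: continuous_on_ae_eq => //.
by apply: ae_imply2 Wu uU => x Wx ux xl; rewrite Wx// ux.
Qed.

Lemma in_H1_rep l u : 0 < l -> in_H1 l u -> exists U,
  primitive l U (wderiv l u) /\ (\forall x \ae mu, x \in `[0, l] -> u x = U x).
Proof.
move=> l0 uH1.
have [U] := weak_deriv_primitive l0 (in_L2_integrable uH1.1) (wderivP uH1).
by exists U.
Qed.

End Representative.

(** * Continuity, measurability and identification of [wderiv] *)

Section EdgeBalance.
Context {R : realType}.
Implicit Types (a b x y l : R) (f g h u v U V : R -> R).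

Lemma continuous_onD a b f g : continuous_on a b f -> continuous_on a b g ->
  continuous_on a b (fun x => f x + g x).
Proof.
move=> /continuous_onP cf /continuous_onP cg; apply/continuous_onP => x xab.
by apply: cvgD; [exact: cf|exact: cg].
Qed.

Lemma continuous_onM a b f g : continuous_on a b f -> continuous_on a b g ->
  continuous_on a b (fun x => f x * g x).
Proof.
move=> /continuous_onP cf /continuous_onP cg; apply/continuous_onP => x xab.
by apply: cvgM; [exact: cf|exact: cg].
Qed.

Lemma continuous_on_cst a b (k : R) : continuous_on a b (fun=> k).
Proof. by apply: continuous_subspaceT => x; exact: cvg_cst. Qed.

Lemma continuous_on_norm a b f : continuous_on a b f ->
  continuous_on a b (fun x => `|f x|).
Proof.
move=> /continuous_onP cf; apply/continuous_onP => x xab.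
by apply: cvg_norm; exact: cf.
Qed.

Lemma continuous_onX a b f n : continuous_on a b f ->
  continuous_on a b (fun x => f x ^+ n).
Proof.
move=> cf; elim: n => [|n IH]; first exact: continuous_on_cst.
rewrite (_ : (fun _ => _) = (fun x => f x * f x ^+ n)); first exact: continuous_onM.
by apply/funext => x; rewrite exprS.
Qed.

(** The reciprocal is [f] times a real power of [f ^+ 2], and real powers are measurable; where [f]
    vanishes both sides are 0. *)
Lemma measurable_inv (D : set R) f : measurable_fun D f ->
  measurable_fun D (fun x => (f x)^-1).
Proof.
move=> mf; rewrite (_ : (fun _ => _) = fun x => f x * (f x ^+ 2) `^ (-1)).
  apply: measurable_funM => //.
  by apply: (measurableT_comp (measurable_powR (-1))); exact: measurable_funX.
apply/funext => x; rewrite powR_inv1 ?sqr_ge0// expr2 invfM.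
by have [->|fx0] := eqVneq (f x) 0; rewrite ?invr0 ?mul0r// mulVKf.
Qed.

Lemma ae_eq_integrable a b f g : measurable_fun `[a, b] f ->
  integrable_on a b g -> (\forall x \ae mu, x \in `[a, b] -> f x = g x) ->
  integrable_on a b f.
Proof.
move=> mf /integrableP[mg gi] fg; apply/integrableP; split.
  exact/measurable_EFinP.
rewrite (@ae_eq_integral _ _ _ mu `[a, b]%classic (fun x => `|(EFin \o g) x|%E))//.
- exact/measurableT_comp/measurable_EFinP.
- exact/measurableT_comp.
- by apply: ae_imply fg => x fgx xab; rewrite /= fgx.
Qed.

(** The tool for computing the weak derivatives of composite expressions in the momentum equation:
    exhibiting a square integrable density proves existence, and uniqueness then determines the
    value chosen by [wderiv]. *)
Lemma wderiv_of_primitive l U g u : 0 < l -> primitive l U g ->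
  square_integrable l g -> measurable_fun `[0, l] u ->
  (\forall x \ae mu, x \in `[0, l] -> u x = U x) ->
  \forall x \ae mu, x \in `[0, l] -> wderiv l u x = g x.
Proof.
move=> l0 Ug g2 mfu uU; apply: wderiv_ae_eq => //.
  apply: ae_eq_integrable uU => //; apply: continuous_on_integrable.
  exact: primitive_continuous (ltW l0) Ug.
exact: is_weak_deriv_primitive (ltW l0) Ug _ _ _.
Qed.

(** * Mass and energy balance on one edge at a fixed time *)

Section Balance.
Variables (l ea eb ec gamma : R) (rho m drho dm : R -> R).
Hypotheses (l_gt0 : 0 < l) (gamma_gt1 : 1 < gamma).
Hypotheses (rho_H1 : in_H1 l rho) (m_H2 : in_H2 l m).
Variable r0 : R.
Hypotheses (r0_gt0 : 0 < r0)
  (rho_ge : \forall x \ae mu, x \in `[0, l] -> r0 <= rho x).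
Hypotheses (mdrho : measurable_fun `[0, l] drho) (mdm : measurable_fun `[0, l] dm).

Let press r := ec * r `^ gamma.
(** The derivative [P'] of the potential. The relation [p' = r P''] lets the pressure term of the
    momentum equation be absorbed into the energy flux. *)
Let enthalpy r := ec * gamma / (gamma - 1) * r `^ (gamma - 1).

Hypothesis mass_eq : \forall x \ae mu, x \in `[0, l] -> drho x + wderiv l m x = 0.
Hypothesis momentum_eq : \forall x \ae mu, x \in `[0, l] ->
  dm x + wderiv l (fun y => m y ^+ 2 / rho y + press (rho y)) x =
  ea * rho x * wderiv l (fun y => 1 / rho y ^+ 2 * wderiv l m y) x
  - eb * (`|m x| * m x / rho x).

Let power x := m x / rho x * dm x
  + (enthalpy (rho x) - m x ^+ 2 / (2 * rho x ^+ 2)) * drho x.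
Let dissip x := ea / rho x ^+ 2 * `|wderiv l m x| ^+ 2
  + eb * (`|m x| ^+ 3 / rho x ^+ 2).
Let rr := cont_rep l rho.
Let mm := cont_rep l m.
Let nn := cont_rep l (wderiv l m).
Let flux x := mm x *
  (ea / rr x ^+ 2 * nn x - (mm x ^+ 2 / (2 * rr x ^+ 2) + enthalpy (rr x))).

Lemma H1_rep u : in_H1 l u -> primitive l (cont_rep l u) (wderiv l u) /\
  (\forall x \ae mu, x \in `[0, l] -> u x = cont_rep l u x).
Proof.
move=> uH1; have [U [Ug uU]] := in_H1_rep l_gt0 uH1.
have UE := cont_repE l_gt0 (primitive_continuous (ltW l_gt0) Ug) uU.
split; first by apply: eq_primitive Ug => x xl; rewrite UE.
by apply: ae_imply uU => x ux xl; rewrite UE ?ux.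
Qed.

Lemma eq_primitive_ae U g h : primitive l U g -> measurable_fun `[0, l] h ->
  (\forall x \ae mu, x \in `[0, l] -> h x = g x) -> primitive l U h.
Proof.
move=> [gi Ug] mh hg; have hi := ae_eq_integrable mh gi hg.
split => // x xl; rewrite Ug//; congr (_ + _).
move: xl; rewrite in_itv/= => /andP[_ xl].
apply: ae_eq_Rintegral.
- have : integrable_on 0 x g by exact: integrable_onS gi.
  by case/integrableP => /measurable_EFinP.
- have : integrable_on 0 x h by exact: integrable_onS hi.
  by case/integrableP => /measurable_EFinP.
- apply: ae_imply hg => z hgz zx; rewrite hgz//; move: zx.
  by rewrite !in_itv/= => /andP[-> zx]; exact: le_trans xl.
Qed.

Let nn_prim : primitive l nn (wderiv l (wderiv l m)).
Proof. by have [] := H1_rep m_H2.2. Qed.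

Let mm_prim : primitive l mm nn.
Proof.
have [mP _] := H1_rep m_H2.1; have [nP nE] := H1_rep m_H2.2.
apply: eq_primitive_ae mP _ _.
  exact: continuous_on_measurable (primitive_continuous (ltW l_gt0) nP).
by apply: ae_imply nE => x + xl => ->.
Qed.

Let rr_prim : primitive l rr (wderiv l rho).
Proof. by have [] := H1_rep rho_H1. Qed.

(** Written as an equality between [rr] and the continuous function [max r0 rr], the almost
    everywhere bound extends to every point, in particular to the end points where traces are
    taken. *)
Lemma rho_rep_ge x : x \in `[0, l] -> r0 <= rr x.
Proof.
move=> xl; have crr := primitive_continuous (ltW l_gt0) rr_prim.
have cmax : continuous_on 0 l (fun x => (r0 + rr x + `|r0 + -1 * rr x|) * 2^-1).
  apply: continuous_onM; last exact: continuous_on_cst.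
  apply: continuous_onD; last apply: continuous_on_norm; apply: continuous_onD;
    do ?[exact: continuous_on_cst|exact: crr].
  by apply: continuous_onM => //; exact: continuous_on_cst.
have maxE y : (r0 + y + `|r0 + -1 * y|) * 2^-1 = Num.max r0 y.
  by rewrite mulN1r maxr_absE.
rewrite (continuous_on_ae_eq l_gt0 crr cmax)// ?maxE ?le_max ?lexx//.
have [_ rE] := H1_rep rho_H1.
apply: ae_imply2 rE rho_ge => y ry r0y yl; rewrite maxE; apply/esym/max_idPr.
by rewrite -[X in _ <= X](ry yl) r0y.
Qed.


Let rr_neq0 x : x \in `[0, l] -> rr x != 0.
Proof. by move=> xl; rewrite gt_eqF// (lt_le_trans r0_gt0)// rho_rep_ge. Qed.

Let rr_gt0 x : x \in `[0, l] -> 0 < rr x.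
Proof. by move=> xl; rewrite (lt_le_trans r0_gt0)// rho_rep_ge. Qed.

Let ir x := (rr x)^-1.
Let gR := wderiv l rho.
Let gN := wderiv l (wderiv l m).

Let l_ge0 : 0 <= l. Proof. exact: ltW. Qed.
Let crr : continuous_on 0 l rr. Proof. exact: primitive_continuous rr_prim. Qed.
Let cmm : continuous_on 0 l mm. Proof. exact: primitive_continuous mm_prim. Qed.
Let cnn : continuous_on 0 l nn. Proof. exact: primitive_continuous nn_prim. Qed.
Let ir_prim := primitiveV l_ge0 rr_prim rr_neq0.
Let cir : continuous_on 0 l ir. Proof. exact: primitive_continuous ir_prim. Qed.
Let cpow p : continuous_on 0 l (fun x => rr x `^ p).
Proof. exact: primitive_continuous (primitive_powR p l_ge0 rr_prim rr_gt0). Qed.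

Let gR2 : square_integrable l gR.
Proof. by apply/in_L2P; case: (wderivP rho_H1). Qed.
Let gN2 : square_integrable l gN.
Proof. by apply/in_L2P; case: (wderivP m_H2.2). Qed.

(** The densities [gQ], [gS], [gH] and [gK] belong to the momentum flux, to [m' / rho^2], to [head]
    and to the energy flux. In [gQ] and [gS], the factors [gR] and [gN], known only in L^2, occur
    linearly with continuous coefficients, and square integrability follows from this form. *)
Let gQ x := 2 * mm x * nn x * ir x
  + (ec * gamma * rr x `^ (gamma - 1) + (-1) * mm x ^+ 2 * ir x ^+ 2) * gR x.
Let gS x := ir x ^+ 2 * gN x + ((-2) * ir x ^+ 3 * nn x) * gR x.
Let gH x := mm x * nn x * ir x ^+ 2
  + (ec * gamma * rr x `^ (gamma - 1 - 1) - mm x ^+ 2 * ir x ^+ 3) * gR x.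
Let head x := mm x ^+ 2 / (2 * rr x ^+ 2) + enthalpy (rr x).
Let gK x := nn x * (ea / rr x ^+ 2 * nn x - head x) + mm x * (ea * gS x - gH x).

Let Q_prim : primitive l (fun x => mm x ^+ 2 / rr x + press (rr x)) gQ.
Proof.
apply: eq_primitive_deriv (primitiveD
  (primitiveM l_ge0 (primitive_sqr l_ge0 mm_prim) ir_prim)
  (primitiveZ ec (primitive_powR gamma l_ge0 rr_prim rr_gt0))) => x xl.
by rewrite /gQ /ir /gR; field; exact: rr_neq0.
Qed.

Let S_prim : primitive l (fun x => 1 / rr x ^+ 2 * nn x) gS.
Proof.
apply: eq_primitive (eq_primitive_deriv _
  (primitiveM l_ge0 (primitive_sqr l_ge0 ir_prim) nn_prim)) => x xl.
  by rewrite div1r exprVn.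
by rewrite /gS /ir /gR /gN; field; exact: rr_neq0.
Qed.

Let H_prim : primitive l head gH.
Proof.
have g10 : gamma - 1 != 0 by rewrite gt_eqF// subr_gt0.
apply: eq_primitive (eq_primitive_deriv _ (primitiveD
  (primitiveZ 2^-1 (primitiveM l_ge0 (primitive_sqr l_ge0 mm_prim)
    (primitive_sqr l_ge0 ir_prim)))
  (primitiveZ (ec * gamma / (gamma - 1))
    (primitive_powR (gamma - 1) l_ge0 rr_prim rr_gt0)))) => x xl.
  by rewrite /head /enthalpy; field; rewrite g10 rr_neq0.
rewrite /gH /ir /gR; field.
by rewrite g10 rr_neq0.
Qed.

Let K_prim : primitive l flux gK.
Proof.
apply: eq_primitive (eq_primitive_deriv _ (primitiveM l_ge0 mm_prim
  (primitiveD (primitiveZ ea S_prim) (primitiveZ (-1) H_prim)))) => x xl.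
  by rewrite /flux -/(head x) div1r; ring.
by rewrite /gK div1r; ring.
Qed.

Let mrho : measurable_fun `[0, l] rho.
Proof. by have /in_L2P[] := rho_H1.1. Qed.
Let m_meas : measurable_fun `[0, l] m.
Proof. by have /in_L2P[] := m_H2.1.1. Qed.
Let mwm : measurable_fun `[0, l] (wderiv l m).
Proof. by have /in_L2P[] := m_H2.2.1. Qed.
Let mpow p : measurable_fun `[0, l] (fun x => rho x `^ p).
Proof. exact: (measurableT_comp (measurable_powR p)). Qed.

Let rhoE : \forall x \ae mu, x \in `[0, l] -> rho x = rr x.
Proof. by have [] := H1_rep rho_H1. Qed.
Let mE : \forall x \ae mu, x \in `[0, l] -> m x = mm x.
Proof. by have [] := H1_rep m_H2.1. Qed.
Let wmE : \forall x \ae mu, x \in `[0, l] -> wderiv l m x = nn x.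
Proof. by have [] := H1_rep m_H2.2. Qed.

Let dQ : \forall x \ae mu, x \in `[0, l] ->
  wderiv l (fun y => m y ^+ 2 / rho y + press (rho y)) x = gQ x.
Proof.
apply: wderiv_of_primitive l_gt0 Q_prim _ _ _.
- apply: square_integrableD.
    apply: square_integrable_continuous; do ?apply: continuous_onM => //.
    exact: continuous_on_cst.
  apply: square_integrable_contM => //; apply: continuous_onD.
    by do ?apply: continuous_onM => //; exact: continuous_on_cst.
  by do ?apply: continuous_onM => //; exact: continuous_on_cst.
- apply: measurable_funD; apply: measurable_funM => //.
    exact: measurable_funX.
  exact: measurable_inv.
- by apply: ae_imply2 rhoE mE => x + + xl => /(_ xl)-> /(_ xl)->.
Qed.

Let dS : \forall x \ae mu, x \in `[0, l] ->
  wderiv l (fun y => 1 / rho y ^+ 2 * wderiv l m y) x = gS x.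
Proof.
apply: wderiv_of_primitive l_gt0 S_prim _ _ _.
- apply: square_integrableD; apply: square_integrable_contM => //.
    exact: continuous_onX.
  by do ?apply: continuous_onM => //; exact: continuous_on_cst.
- apply: measurable_funM => //; apply: measurable_funM => //.
  by apply: measurable_inv; exact: measurable_funX.
- by apply: ae_imply2 rhoE wmE => x + + xl => /(_ xl)-> /(_ xl)->.
Qed.

(** The dissipation density in terms of continuous representatives, hence integrable by continuity
    alone. *)
Let visc x := ea * nn x ^+ 2 * ir x ^+ 2 + eb * `|mm x| ^+ 3 * ir x ^+ 2.

Let power_ae : \forall x \ae mu, x \in `[0, l] -> power x = gK x - visc x.
Proof.
have := ae_imply2 _ (ae_and rhoE mE)
  (ae_and wmE (ae_and mass_eq
  (ae_and momentum_eq (ae_and dQ dS)))).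
apply => x [rx mx] [wx [massx [momx [Qx Sx]]]] xl.
have rx0 := rr_neq0 xl; have g10 : gamma - 1 != 0 by rewrite gt_eqF// subr_gt0.
move: (momx xl) (massx xl); rewrite (Qx xl) (Sx xl) (rx xl) (mx xl) (wx xl).
rewrite /power /gK /visc /head /gQ /gS /gH /enthalpy (rx xl) (mx xl).
(* Once a single real power of [rr x] is left, and the cube of the absolute value is split, the
   claim is a rational identity in independent quantities. *)
have -> : rr x `^ (gamma - 1) = rr x `^ (gamma - 1 - 1) * rr x.
  by rewrite -[X in _ * X]powRr1 ?ltW ?rr_gt0// -powRD ?subrK// rx0 implybT.
have -> : `|mm x| ^+ 3 = `|mm x| * mm x ^+ 2.
  by rewrite exprS real_normK ?num_real.
move: (rr x `^ _) (gR x) (gN x) `|mm x| rx0 => X GR GN A rx0.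
(* The momentum equation eliminates [dm x] and the mass equation eliminates [drho x]. *)
move=> /(canRL (addrK _)) -> /(canRL (addrK _)) ->.
rewrite /ir; field.
by rewrite rx0.
Qed.

Lemma edge_balance :
  \I_(0, l) power + \I_(0, l) dissip = flux l - flux 0.
Proof.
have cvisc : continuous_on 0 l visc.
  have cnm := continuous_on_norm cmm.
  by apply: continuous_onD; do ?apply: continuous_onM => //; exact:
    continuous_on_cst.
have vi := continuous_on_integrable cvisc.
have [Ki Kl] := K_prim.
have -> : \I_(0, l) dissip = \I_(0, l) visc.
  apply: ae_eq_Rintegral; last 2 first.
  - exact: continuous_on_measurable.
  - apply: ae_imply2 (ae_and rhoE mE) wmE.
    move=> x [rx mx] wx xl; rewrite /dissip /visc (rx xl) (mx xl) (wx xl) /ir.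
    by rewrite real_normK ?num_real// !exprVn; ring.
  have mr2 : measurable_fun `[0, l] (fun x => (rho x ^+ 2)^-1).
    by apply: measurable_inv; exact: measurable_funX.
  have mnm : measurable_fun `[0, l] (fun x => `|m x|) by exact: measurableT_comp.
  have mnw : measurable_fun `[0, l] (fun x => `|wderiv l m x|) by exact:
    measurableT_comp.
  by apply: measurable_funD; do ?apply: measurable_funM => //.
have -> : \I_(0, l) power = \I_(0, l) (fun x => gK x - visc x).
  apply: ae_eq_Rintegral; [|by case/integrableP: (integrable_onB Ki vi) =>
    /measurable_EFinP|exact: power_ae].
  have mri : measurable_fun `[0, l] (fun x => (rho x)^-1) by exact: measurable_inv.
  apply: measurable_funD; apply: measurable_funM => //; first exact:
    measurable_funM.
  apply: measurable_funB; first exact: measurable_funM.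
  apply: measurable_funM; first exact: measurable_funX.
  by apply: measurable_inv; apply: measurable_funM => //; exact: measurable_funX.
rewrite RintegralB// subrK Kl ?in_itv/= ?l_ge0 ?lexx//; ring.
Qed.

Lemma edge_mass_balance : \I_(0, l) drho = - (mm l - mm 0).
Proof.
have [ni Ml] := mm_prim.
rewrite (@ae_eq_Rintegral _ _ _ _ (fun x => (-1) * nn x))//.
- by rewrite RintegralZl// Ml ?in_itv/= ?l_ge0 ?lexx//; ring.
- by apply: measurable_funM => //; exact: continuous_on_measurable.
- apply: ae_imply2 wmE mass_eq => x wx + xl => /(_ xl)/eqP.
  by rewrite (wx xl) addr_eq0 => /eqP ->; rewrite mulN1r.
Qed.

End Balance.
End EdgeBalance.

(** * Pointwise expansion of the energy density *)

Section EnergyDensity.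
Context {R : realType}.
Implicit Types (a b r s x y z h e p : R).

Lemma powR_mean_value p x y : 0 < x -> 0 < y -> exists2 z,
  Num.min x y <= z <= Num.max x y & y `^ p - x `^ p = p * z `^ (p - 1) * (y - x).
Proof.
move=> x0 y0; wlog xy : x y x0 y0 / x <= y => [wlg|].
  have [yx|xy] := boolP (y <= x); last by apply: wlg => //; rewrite ltW// ltNge.
  have [z zyx E] := wlg _ _ y0 x0 yx; exists z; first by rewrite minC maxC.
  by rewrite -opprB E -mulrN opprB.
have d z : z \in `[x, y] -> is_derive z 1 (@powR R ^~ p) (p * z `^ (p - 1)).
  rewrite in_itv/= => /andP[xz _]; apply: is_derive1_powR; exact: lt_le_trans xz.
have dO z : z \in `]x, y[ -> is_derive z 1 (@powR R ^~ p) (p * z `^ (p - 1)).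
  by move=> /subset_itv_oo_cc; exact: d.
have cp : continuous_on x y (@powR R ^~ p).
  by apply: derivable_within_continuous => z /d; case.
have [z zxy E] := MVT_segment xy dO cp.
by exists z => //; rewrite min_l ?max_r//; move: zxy; rewrite in_itv.
Qed.

Lemma powR_bounded p a b : 0 < a -> exists2 M : R, 0 < M &
  forall x, a <= x <= b -> x `^ p <= M.
Proof.
move=> a0; have cp : continuous_on a b (@powR R ^~ p).
  apply: derivable_within_continuous => z; rewrite in_itv/= => /andP[az _].
  by have [] := is_derive1_powR p (lt_le_trans a0 az).
have [M M0 pM] := continuous_on_bounded cp; exists M => // x xab.
by rewrite (le_trans (ler_norm _))// pM.
Qed.

(** The mean value theorem is applied twice, to the power [p] and then to the power [p - 1] between
    [x] and the intermediate point, which is no farther from [x] than [y] is. *)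
Lemma powR_taylor p a b : 0 < a -> exists2 M : R, 0 < M & forall x y,
  a <= x <= b -> a <= y <= b ->
  `|y `^ p - x `^ p - p * x `^ (p - 1) * (y - x)| <= M * (y - x) ^+ 2.
Proof.
move=> a0; have [M M0 pM] := powR_bounded (p - 1 - 1) b a0.
exists (`|p * (p - 1)| * M + 1) => [|x y /[dup] xab /andP[ax xb] /andP[ay yb]].
  by rewrite ltr_pwDr// mulr_ge0// ltW.
have x0 := lt_le_trans a0 ax; have y0 := lt_le_trans a0 ay.
have [z /andP[zmin zmax] ->] := powR_mean_value p x0 y0.
have az : a <= z by rewrite (le_trans _ zmin)// le_min ax.
have zb : z <= b by rewrite (le_trans zmax)// ge_max xb.
have [w /andP[wmin wmax] E] := powR_mean_value (p - 1) x0 (lt_le_trans a0 az).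
have aw : a <= w by rewrite (le_trans _ wmin)// le_min ax.
have wb : w <= b by rewrite (le_trans wmax)// ge_max xb.
have zxyx : `|z - x| <= `|y - x|.
  move: zmin zmax; case: (leP x y) => xy zmin zmax.
    by rewrite !ger0_norm ?subr_ge0// lerB.
  by rewrite !ler0_norm ?subr_le0// ?(ltW xy)// lerN2 lerB.
rewrite -mulrBl -mulrBr E.
rewrite (_ : p * _ * _ = p * (p - 1) * w `^ (p - 1 - 1) * ((z - x) * (y - x)));
  last by ring.
rewrite normrM -[(y - x) ^+ 2]real_normK ?num_real// ler_pM//.
  rewrite normrM (le_trans (y := `|p * (p - 1)| * M))// ?lerDl//.
  by rewrite ler_wpM2l// ger0_norm ?powR_ge0// pM// aw.
by rewrite normrM expr2 ler_wpM2r.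
Qed.

Variables (c gamma : R).
Hypothesis gamma_gt1 : 1 < gamma.

Definition energy_density r m : R := m ^+ 2 / (2 * r) + c / (gamma - 1) * r `^
  gamma.

(** The differential of [energy_density] at [(r, m)] applied to [(dr, dm)], given by its formula so
    that no calculus in two variables is involved. *)
Definition energy_power r m dr dm : R := m / r * dm
  + (c * gamma / (gamma - 1) * r `^ (gamma - 1) - m ^+ 2 / (2 * r ^+ 2)) * dr.

(** The kinetic remainder is the relative kinetic energy [s (n/s - m/r)^2 / 2], that is, the new
    density times half the squared jump of the velocity. *)
Lemma energy_density_bregman r s m n : r != 0 -> s != 0 ->
  energy_density s n - energy_density r m - energy_power r m (s - r) (n - m) =
  (n - m - m / r * (s - r)) ^+ 2 / (2 * s)
  + c / (gamma - 1) * (s `^ gamma - r `^ gamma - gamma * r `^ (gamma - 1) * (s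
    - r)).
Proof.
move=> r0 s0; rewrite /energy_density /energy_power.
move: (s `^ _) (r `^ _) (r `^ _) => A B C.
have g0 : gamma - 1 != 0 by rewrite gt_eqF// subr_gt0.
by field; rewrite r0 s0 g0.
Qed.

Lemma energy_powerZ r m dr dm h :
  energy_power r m (h * dr) (h * dm) = h * energy_power r m dr dm.
Proof. rewrite /energy_power; ring. Qed.

Lemma energy_power_bound a b (M : R) : 0 < a -> exists2 B : R, 0 < B & forall r m,
  a <= r <= b -> `|m| <= M ->
  `|m / r| <= B /\ forall dr dm, `|energy_power r m dr dm| <= B * `|dm| + B * `|dr|.
Proof.
move=> a0; have [P P0 powP] := powR_bounded (gamma - 1) b a0.
exists (`|M| / a + `|c * gamma / (gamma - 1)| * P + (`|M| / a) ^+ 2 + 1).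
  by rewrite ltr_pwDr// ?addr_ge0// ?sqr_ge0// ?mulr_ge0// ?invr_ge0 ?ltW.
move=> r m /[dup] rab /andP[ar rb] mM.
have r0 := lt_le_trans a0 ar.
have mr : `|m / r| <= `|M| / a.
  rewrite normrM normfV (gtr0_norm r0) ler_pM// ?invr_ge0 ?(ltW r0)//.
    by rewrite (le_trans mM)// ler_norm.
  by rewrite lef_pV2.
have Ma0 : 0 <= `|M| / a by rewrite divr_ge0// ltW.
have cP0 : 0 <= `|c * gamma / (gamma - 1)| * P by rewrite mulr_ge0// ltW.
have Ma2 := sqr_ge0 (`|M| / a).
have mrB : `|m / r| <= `|M| / a + `|c * gamma / (gamma - 1)| * P + (`|M| / a)
  ^+ 2 + 1.
  by rewrite (le_trans mr)// -!addrA lerDl !addr_ge0.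
split => // dr dm; rewrite /energy_power (le_trans (ler_normD _ _))//.
apply: lerD; first by rewrite normrM ler_wpM2r.
rewrite normrM ler_wpM2r// (le_trans (ler_normB _ _))//.
rewrite -!addrA addrCA; apply: lerD.
  by rewrite normrM ler_wpM2l// ger0_norm ?powR_ge0// powP.
rewrite -[leLHS]add0r lerD// ler_wpDr//.
rewrite (_ : m ^+ 2 / _ = (m / r) ^+ 2 / 2); last by field; rewrite gt_eqF.
rewrite normrM normrX (@ger0_norm _ 2^-1)// -[leRHS]mulr1.
by rewrite ler_pM// ?sqr_ge0//; [rewrite lerXn2r ?nnegrE|rewrite invf_le1 ?ler1n].
Qed.

(** The bound is designed to be integrated: the density quotient has a uniform error [e], while [dm]
    and the error of the momentum quotient appear only squared. There is no bound on [n], and [C]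
    depends neither on [h] nor on [e]. *)
Lemma energy_density_increment a b (M K : R) : 0 < a ->
  exists2 C : R, 0 < C & forall r s m n dr dm h e,
  a <= r <= b -> `|m| <= M -> `|dr| <= K -> h != 0 -> 0 < e <= 1 ->
  `|h| * (K + 1) <= a / 2 -> `|(s - r) / h - dr| <= e ->
  `|(energy_density s n - energy_density r m) / h - energy_power r m dr dm| <=
  C * (`|h| * (1 + dm ^+ 2 + ((n - m) / h - dm) ^+ 2)
       + e + ((n - m) / h - dm) ^+ 2 / e).
Proof.
move=> a0.
have [B B0 powB] := energy_power_bound b M a0.
have [P P0 powP] := powR_taylor gamma (b + a / 2) (divr_gt0 a0 (ltr0n _ 2)).
(* The 3 comes from bounding the square of a sum of three terms, and [1 / a] from [1 / (2 * s)] with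
   [s >= a / 2]. [C2] collects the velocity term and the Taylor remainder of the power; [2 * B] will
   come from the linear part. *)
pose C1 := 3 / a.
pose C2 := 3 / a * (B * (K + 1)) ^+ 2 + `|c / (gamma - 1)| * (P * (K + 1) ^+ 2).
exists (C1 + C2 + 2 * B) => [|r s m n dr dm h e /[dup] rab /andP[ar rb] mM drK
  h0 /andP[e0 e1] hK].
  rewrite ltr_wpDl ?mulr_gt0// addr_ge0// ?divr_ge0 ?(ltW a0)// /C2 addr_ge0//.
    by rewrite mulr_ge0 ?sqr_ge0// divr_ge0// ltW.
  by rewrite mulr_ge0// (mulr_ge0 (ltW P0))// sqr_ge0.
set f := (s - r) / h - dr; set g := (n - m) / h - dm => fe.
have r0 := lt_le_trans a0 ar.
have sE : s - r = h * (dr + f) by rewrite /f; field.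
have nE : n - m = h * (dm + g) by rewrite /g; field.
have K0 : 0 <= K by rewrite (le_trans _ drK).
have drf : `|dr + f| <= K + 1.
  by rewrite (le_trans (ler_normD _ _))// lerD// (le_trans fe).
have sr : `|s - r| <= a / 2.
  by rewrite sE normrM (le_trans _ hK)// ler_wpM2l.
have [sa sb] : a / 2 <= s /\ s <= b + a / 2.
  by move: sr; rewrite ler_norml => /andP[]; move: (a / 2) (splitr a) => d; lra.
have s0 : 0 < s by rewrite (lt_le_trans _ sa)// divr_gt0.
have [mrB powE] := powB _ _ rab mM.
(* With increments [h * (dr + f)] and [h * (dm + g)], the quadratic remainder keeps a factor [h]
   after division, and the linear part leaves only its value on the errors [f] and [g]. *)
have -> : (energy_density s n - energy_density r m) / h - energy_power r m dr dm =
  h * ((dm + g - m / r * (dr + f)) ^+ 2 / (2 * s))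
  + c / (gamma - 1) * ((s `^ gamma - r `^ gamma - gamma * r `^ (gamma - 1) * (s
    - r)) / h)
  + energy_power r m f g.
  have := energy_density_bregman m n (negbT (gt_eqF r0)) (negbT (gt_eqF s0)).
  rewrite {1}sE {1}nE energy_powerZ => /(canRL (subrK _)) ->.
  have -> : energy_power r m (dr + f) (dm + g) = energy_power r m dr dm +
    energy_power r m f g.
    by rewrite /energy_power; ring.
  rewrite nE {1}sE; move: (energy_power r m dr dm) (energy_power r m f g) => p q.
  move: (_ - gamma * _ * _) (m / r) => T w.
  have g0 : gamma - 1 != 0 by rewrite gt_eqF// subr_gt0.
  by field; rewrite h0 g0 gt_eqF.
have k0 := normr_ge0 h; have g2 := sqr_ge0 g; have dm2 := sqr_ge0 dm.
have q0 : 0 <= g ^+ 2 / e by rewrite divr_ge0// ltW.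
have kS : `|h * ((dm + g - m / r * (dr + f)) ^+ 2 / (2 * s))| <=
    C1 * (`|h| * (dm ^+ 2 + g ^+ 2)) + `|h| * (3 / a * (B * (K + 1)) ^+ 2).
  rewrite normrM (_ : C1 * _ + _ = `|h| * (3 * (dm ^+ 2 + g ^+ 2 + (B * (K +
    1)) ^+ 2) / a)); last first.
    by rewrite /C1; ring.
  rewrite ler_wpM2l// ger0_norm; last by rewrite divr_ge0 ?sqr_ge0// mulr_ge0// ltW.
  rewrite ler_pM ?sqr_ge0// ?invr_ge0 ?mulr_ge0 ?(ltW s0)//; last first.
    by rewrite lef_pV2 ?posrE ?mulr_gt0//; move: sa; rewrite ler_pdivrMr// mulrC.
  have wB : (m / r * (dr + f)) ^+ 2 <= (B * (K + 1)) ^+ 2.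
    rewrite -[leLHS]real_normK ?num_real// lerXn2r ?nnegrE ?mulr_ge0 ?addr_ge0
      ?(ltW B0)//.
    by rewrite normrM ler_pM.
  move: (m / r * _) ((B * _) ^+ 2) wB => v W vW.
  have := sqr_ge0 (dm - g); have := sqr_ge0 (dm + v); have := sqr_ge0 (g + v); nra.
have TS : `|c / (gamma - 1) * ((s `^ gamma - r `^ gamma - gamma * r `^ (gamma -
  1) * (s - r)) / h)| <=
    `|h| * (`|c / (gamma - 1)| * (P * (K + 1) ^+ 2)).
  rewrite normrM mulrCA ler_wpM2l// normrM normfV ler_pdivrMr ?normr_gt0//.
  apply: le_trans (powP _ _ _ _) _.
  - by apply/andP; split; move: ar rb (divr_gt0 a0 (ltr0n _ 2)); move: (a / 2)
    (splitr a) => d; lra.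
  - by rewrite sa sb.
  - rewrite sE -[_ ^+ 2]real_normK ?num_real// normrM.
    rewrite (_ : `|h| * _ * `|h| = P * (`|h| * (K + 1)) ^+ 2); last by ring.
    rewrite ler_wpM2l ?(ltW P0)// lerXn2r ?nnegrE ?mulr_ge0 ?addr_ge0//.
    by rewrite ler_wpM2l.
have PS : `|energy_power r m f g| <= 2 * B * e + 2 * B * (g ^+ 2 / e).
  apply: le_trans (powE _ _) _.
  (* AM-GM, as [g] will only be small in L^2 *)
  have ge : `|g| <= e + g ^+ 2 / e.
    rewrite -(ler_pM2r e0) mulrDl divfK ?gt_eqF// -[g ^+ 2]real_normK ?num_real//.
    have := sqr_ge0 (`|g| - e); have := normr_ge0 g; nra.
  by move: ge fe q0 e0 B0; move: `|g| `|f| (_ / e) => x y q; nra.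
rewrite (le_trans (ler_normD _ _))// (le_trans (lerD (ler_normD _ _) (lexx _)))//.
rewrite (le_trans (lerD (lerD kS TS) PS))//.
have C10 : 0 <= C1 by rewrite divr_ge0// ltW.
have C20 : 0 <= C2.
  apply: addr_ge0; first by rewrite mulr_ge0 ?sqr_ge0.
  by rewrite mulr_ge0// (mulr_ge0 (ltW P0))// sqr_ge0.
rewrite [leLHS](_ : _ = C1 * (`|h| * (dm ^+ 2 + g ^+ 2)) + C2 * `|h|
   + 2 * B * (e + g ^+ 2 / e)); last first.
  rewrite /C1 /C2; move: (3 / a) `|_ / _| (_ ^+ 2 / e) => u v w; ring.
have kS0 : 0 <= `|h| * (dm ^+ 2 + g ^+ 2) by rewrite mulr_ge0// addr_ge0.
rewrite [X in _ <= _ * X](_ : _ = `|h| * (dm ^+ 2 + g ^+ 2) + `|h| + (e + g ^+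
  2 / e)); last by ring.
have eq0 : 0 <= e + g ^+ 2 / e by rewrite addr_ge0// ltW.
clearbody C1 C2; move: kS0 k0 eq0 C10 C20 (ltW B0); clear.
move: (`|h| * (dm ^+ 2 + g ^+ 2)) `|h| (e + g ^+ 2 / e) => x y z x0 y0 z0 p0 q0 B0.
have := (mulr_ge0 p0 y0, mulr_ge0 p0 z0, mulr_ge0 q0 x0, mulr_ge0 q0 z0).
by have := (mulr_ge0 B0 x0, mulr_ge0 B0 y0) => -[? ?] [[[? ?] ?] ?]; lra.
Qed.

End EnergyDensity.

(** * Time derivatives of mass and energy on one edge *)

Section EdgeTimeDerivative.
Context {R : realType}.
Implicit Types (a b l t s e : R) (f g : R -> R).

(** Clipping [f] between [-|g|] and [|g|] changes it on a null set only and makes the domination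
    hold everywhere. *)
Lemma ae_le_integrable l f g : measurable_fun `[0, l] f ->
  integrable_on 0 l g -> (\forall x \ae mu, x \in `[0, l] -> `|f x| <= g x) ->
  integrable_on 0 l f.
Proof.
move=> mf gi fg; have [/measurable_EFinP mg _] := integrableP _ _ _ gi.
apply: (@ae_eq_integrable _ _ _ _ (fun x => Num.max (- `|g x|) (Num.min `|g x|
  (f x)))) => //.
  apply: (@le_integrable _ _ _ mu `[0, l]%classic _ _ (EFin \o (fun x => `|g
    x|))) => //.
  - apply/measurable_EFinP; apply: measurable_maxr.
      by apply: measurableT_comp => //; exact: measurableT_comp.
    by apply: measurable_minr => //; exact: measurableT_comp.
  - move=> x _ /=; rewrite lee_fin normr_id ler_norml le_max lexx/= ge_max.
    by rewrite ge_min lexx ge0_cp.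
  - exact: integrable_norm.
apply: ae_imply fg => x + xl => /(_ xl) fgx.
have /ler_normlP[fg1 fg2] := le_trans fgx (ler_norm _).
by rewrite min_r ?max_r// lerNl.
Qed.

Lemma ae_le_Rintegral l f g : integrable_on 0 l f -> integrable_on 0 l g ->
  (\forall x \ae mu, x \in `[0, l] -> f x <= g x) ->
  \I_(0, l) f <= \I_(0, l) g.
Proof.
move=> fi gi fg; rewrite -subr_ge0 -RintegralB//.
have [/measurable_EFinP mgf _] := integrableP _ _ _ (integrable_onB gi fi).
rewrite (@ae_eq_Rintegral _ _ _ _ (fun x => Num.max 0 (g x - f x)))//.
- by apply: Rintegral_ge0 => x _; rewrite le_max lexx.
- exact: measurable_maxr.
- by apply: ae_imply fg => x fgx xl; rewrite max_r// subr_ge0 fgx.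
Qed.

Lemma square_integrableZ l (k : R) f : square_integrable l f ->
  square_integrable l (fun x => k * f x).
Proof. by apply: square_integrable_contM; exact: continuous_on_cst. Qed.

Lemma Rintegral_cst_itv l (k : R) : 0 <= l -> \I_(0, l) (fun=> k) = k * l.
Proof.
move=> l0; have [i1 /(_ l)] := primitive_id l.
rewrite in_itv/= l0 lexx add0r => /(_ isT) {2}->.
by rewrite -RintegralZl//; under [RHS]eq_Rintegral do rewrite mulr1.
Qed.

Section EnergyDerivative.
Variables (l c gamma : R) (l_gt0 : 0 < l) (gamma_gt1 : 1 < gamma).
Local Notation density := (energy_density c gamma).
Local Notation lin := (energy_power c gamma).

Lemma integrable_density a b (r m : R -> R) : 0 < a ->
  measurable_fun `[0, l] r -> square_integrable l m ->
  (\forall x \ae mu, x \in `[0, l] -> a <= r x <= b) ->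
  integrable_on 0 l (fun x => density (r x) (m x)).
Proof.
move=> a0 mr [mm mi] rab; have [P P0 rP] := powR_bounded gamma b a0.
apply: (@ae_le_integrable _ _ (fun x => (2 * a)^-1 * m x ^+ 2 + `|c / (gamma -
  1)| * P)).
- apply: measurable_funD; apply: measurable_funM => //.
  + exact: measurable_funX.
  + by apply: measurable_inv; exact: measurable_funM.
  + exact: (measurableT_comp (measurable_powR gamma)).
- apply: integrable_onD; first exact: integrable_onZ.
  exact/continuous_on_integrable/continuous_on_cst.
apply: ae_imply rab => x + xl => /(_ xl) /[dup] rxab /andP[ar rb].
have r0 := lt_le_trans a0 ar.
rewrite (le_trans (ler_normD _ _))//; apply: lerD.
  rewrite ger0_norm; last by rewrite divr_ge0 ?sqr_ge0// mulr_ge0// ltW.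
  rewrite mulrC ler_wpM2r ?sqr_ge0// lef_pV2 ?posrE ?mulr_gt0//.
  by rewrite ler_wpM2l.
by rewrite normrM ler_wpM2l// ger0_norm ?powR_ge0// rP.
Qed.

Lemma integrable_power a b M (r m dr dm : R -> R) : 0 < a ->
  measurable_fun `[0, l] r -> measurable_fun `[0, l] m ->
  integrable_on 0 l dr -> integrable_on 0 l dm ->
  (\forall x \ae mu, x \in `[0, l] -> a <= r x <= b) ->
  (\forall x \ae mu, x \in `[0, l] -> `|m x| <= M) ->
  integrable_on 0 l (fun x => lin (r x) (m x) (dr x) (dm x)).
Proof.
move=> a0 mr mm dri dmi rab mM.
have [B B0 powB] := energy_power_bound c gamma b M a0.
have [/measurable_EFinP mdr _] := integrableP _ _ _ dri.
have [/measurable_EFinP mdm _] := integrableP _ _ _ dmi.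
apply: (@ae_le_integrable _ _ (fun x => B * `|dm x| + B * `|dr x|)).
- have mri : measurable_fun `[0, l] (fun x => (r x)^-1) by exact: measurable_inv.
  apply: measurable_funD; apply: measurable_funM => //; first exact:
    measurable_funM.
  apply: measurable_funB.
    apply: measurable_funM => //; exact: (measurableT_comp (measurable_powR _)).
  apply: measurable_funM; first exact: measurable_funX.
  by apply: measurable_inv; apply: measurable_funM => //; exact: measurable_funX.
- by apply: integrable_onD; apply: integrable_onZ; exact: integrable_norm.
- by apply: ae_imply2 rab mM => x + + xl => /(_ xl) rx /(_ xl) mx; have [_] :=
  powB _ _ rx mx.
Qed.

(** [F] stands for the punctured neighbourhoods of [t] within [[0, T]]; keeping it abstract treats
    interior times and the one-sided limit at [T] alike. *)
Variables (F : set_system R) (FF : Filter F) (t : R).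
Hypotheses (Ft : s @[s --> F] --> t) (Fneq : \forall s \near F, s != t).
Variables (rho m : R -> R -> R) (drho dm : R -> R).

Lemma edge_mass_deriv :
  integrable_on 0 l drho -> integrable_on 0 l (rho t) ->
  (\forall s \near F, integrable_on 0 l (rho s)) ->
  (forall e, 0 < e -> \forall s \near F, \forall x \ae mu, x \in `[0, l] ->
     `|(rho s x - rho t x) / (s - t) - drho x| <= e) ->
  (\I_(0, l) (rho s) - \I_(0, l) (rho t)) / (s - t) @[s --> F] --> \I_(0, l) drho.
Proof.
move=> dri rti rsi rhoe; apply/cvgrPdist_le => /= e e0.
have el : 0 < e / l by rewrite divr_gt0.
near=> s; have si : integrable_on 0 l (rho s) by near: s.
have rhos : \forall x \ae mu, x \in `[0, l] ->
  `|(rho s x - rho t x) / (s - t) - drho x| <= e / l by near: s; exact: rhoe.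
have qi : integrable_on 0 l (fun x => (rho s x - rho t x) / (s - t)).
  rewrite (_ : (fun _ => _) = fun x => (s - t)^-1 * (rho s x - rho t x)).
    by apply: integrable_onZ; exact: integrable_onB.
  by apply/funext => x; rewrite mulrC.
rewrite distrC -RintegralB// -RintegralZr//; last exact: integrable_onB.
rewrite -RintegralB//.
have di := integrable_onB qi dri.
apply: le_trans (le_normr_Rintegral _ di) _ => //.
have -> : e = e / l * l by rewrite divfK// gt_eqF.
rewrite -(Rintegral_cst_itv _ (ltW l_gt0)).
apply: ae_le_Rintegral rhos; first exact: integrable_norm.
exact/continuous_on_integrable/continuous_on_cst.
Unshelve. all: by end_near. Qed.

Lemma edge_energy_deriv a b M K : 0 < a -> 0 <= K ->
  measurable_fun `[0, l] (rho t) -> square_integrable l (m t) ->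
  integrable_on 0 l drho -> square_integrable l dm ->
  (\forall x \ae mu, x \in `[0, l] -> a <= rho t x <= b) ->
  (\forall x \ae mu, x \in `[0, l] -> `|m t x| <= M) ->
  (\forall x \ae mu, x \in `[0, l] -> `|drho x| <= K) ->
  (\forall s \near F, measurable_fun `[0, l] (rho s) /\ square_integrable l (m
    s)) ->
  (forall e, 0 < e -> \forall s \near F, \forall x \ae mu, x \in `[0, l] ->
     `|(rho s x - rho t x) / (s - t) - drho x| <= e) ->
  (forall e, 0 < e -> \forall s \near F,
     \I_(0, l) (fun x => ((m s x - m t x) / (s - t) - dm x) ^+ 2) <= e ^+ 2) ->
  (\I_(0, l) (fun x => density (rho s x) (m s x))
   - \I_(0, l) (fun x => density (rho t x) (m t x))) / (s - t) @[s --> F] -->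
  \I_(0, l) (fun x => lin (rho t x) (m t x) (drho x) (dm x)).
Proof.
move=> a0 K0 mrt m2 dri dm2 rab mM drK msmt rhoe me.
have [C C0 densC] := energy_density_increment c gamma_gt1 b M K a0.
set I1 := \I_(0, l) (fun x => dm x ^+ 2).
have I10 : 0 <= I1 by apply: Rintegral_ge0 => x _; exact: sqr_ge0.
have lI : 0 < 2 * l + I1 + 2 by have := l_gt0; lra.
apply/cvgrPdist_le => /= eta eta0.
(* After integration the error is at most [C * e * (2 * l + I1 + 2)]: [2 * l] comes from the
   constants [|h|] and [e], [I1] from [dm ^+ 2], and 2 from the mean square error weighted by [|h|]
   and by [1 / e]. *)
pose e := Num.min 1 (eta / (C * (2 * l + I1 + 2))).
have e0 : 0 < e by rewrite lt_min ltr01 divr_gt0// mulr_gt0.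
have e1 : e <= 1 by rewrite ge_min lexx.
have eeta : C * (2 * l + I1 + 2) * e <= eta.
  by rewrite mulrC -ler_pdivlMr ?mulr_gt0// ge_min lexx orbT.
near=> s.
have st : s - t != 0 by rewrite subr_eq0; near: s.
have [mrs ms2] : measurable_fun `[0, l] (rho s) /\ square_integrable l (m s) by
  near: s.
have rhos : \forall x \ae mu, x \in `[0, l] ->
  `|(rho s x - rho t x) / (s - t) - drho x| <= e by near: s; exact: rhoe.
have mse : \I_(0, l) (fun x => ((m s x - m t x) / (s - t) - dm x) ^+ 2) <= e ^+ 2.
  by near: s; exact: me.
have ste : `|s - t| <= e.
  by rewrite distrC; near: s; move/cvgrPdist_le : Ft; exact.
have stK : `|s - t| * (K + 1) <= a / 2.
  rewrite -ler_pdivlMr ?ltr_wpDl// distrC; near: s.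
  by move/cvgrPdist_le : Ft; apply; rewrite !divr_gt0// ltr_wpDl.
set h := s - t in st rhos mse ste stK *.
pose g x := (m s x - m t x) / h - dm x.
have g2 : square_integrable l g.
  rewrite (_ : g = fun x => (h^-1 * m s x + (- h^-1) * m t x) + (-1) * dm x).
    by do 2?apply: square_integrableD; exact: square_integrableZ.
  by apply/funext => x; rewrite /g; ring.
have rt_i := integrable_density a0 mrt m2 rab.
have lin_i := integrable_power a0 mrt m2.1 dri (square_integrable_integrable
  dm2) rab mM.
(* The bounds on the density at time [s] are inherited from time [t] through the uniform control of
   the difference quotient. *)
have rs_ab : \forall x \ae mu, x \in `[0, l] -> a / 2 <= rho s x <= b + a / 2.
  have := ae_and rab (ae_and rhos drK).
  apply: ae_imply => x [rx [rsx drx]] xl; have /andP[ar rb] := rx xl.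
  have : `|rho s x - rho t x| <= a / 2.
    apply: le_trans stK; rewrite -ler_pdivrMl ?normr_gt0// mulrC -normfV -normrM.
    rewrite -(subrK (drho x) (_ / h)) (le_trans (ler_normD _ _))// addrC lerD
      ?drx//.
    exact: le_trans (rsx xl) e1.
  by rewrite ler_norml => /andP[]; move: (a / 2) (splitr a) => d; lra.
have rs_i := integrable_density (divr_gt0 a0 (ltr0n _ 2)) mrs ms2 rs_ab.
rewrite distrC -RintegralB// -RintegralZr//; last exact: integrable_onB.
have q_i : integrable_on 0 l
    (fun x => (density (rho s x) (m s x) - density (rho t x) (m t x)) / h).
  rewrite (_ : (fun _ => _) = fun x => h^-1 * (density (rho s x) (m s x) -
    density (rho t x) (m t x))).
    by apply: integrable_onZ; exact: integrable_onB.
  by apply/funext => x; rewrite mulrC.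
rewrite -RintegralB//; have d_i := integrable_onB q_i lin_i.
apply: le_trans (le_normr_Rintegral _ d_i) _ => //.
(* The coefficients of [dm ^+ 2], of [g ^+ 2] and of 1 in the pointwise bound. *)
pose k1 := C * `|h|; pose k2 := C * (`|h| + e^-1); pose k3 := C * (`|h| + e).
have i3 : integrable_on 0 l (fun=> k3) by
  exact/continuous_on_integrable/continuous_on_cst.
have i1 : integrable_on 0 l (fun x => k1 * dm x ^+ 2) by apply: integrable_onZ;
  exact: dm2.2.
have i2 : integrable_on 0 l (fun x => k2 * g x ^+ 2) by apply: integrable_onZ;
  exact: g2.2.
apply: (@le_trans _ _ (\I_(0, l) (fun x => k1 * dm x ^+ 2 + k2 * g x ^+ 2 + k3))).
  apply: ae_le_Rintegral.
  - exact: integrable_norm.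
  - exact: (integrable_onD (integrable_onD i1 i2) i3).
  have := ae_and (ae_and rab mM)
    (ae_and rhos drK).
  apply: ae_imply => x [[rx mx] [rsx drx]] xl.
  have ee : 0 < e <= 1 by rewrite e0.
  apply: le_trans (densC _ _ _ _ _ _ _ _ (rx xl) (mx xl) (drx xl) st ee stK
    (rsx xl)) _.
  by rewrite -/(g x) le_eqVlt; apply/orP; left; apply/eqP; rewrite /k1 /k2 /k3;
    ring.
rewrite RintegralD//; last exact: (integrable_onD i1 i2).
rewrite RintegralD// (RintegralZl _ _ dm2.2)// (RintegralZl _ _ g2.2)//.
rewrite (Rintegral_cst_itv _ (ltW l_gt0)) -/I1.
apply: le_trans eeta.
have k20 : 0 <= k2 by rewrite mulr_ge0 ?ltW// addr_gt0// ?invr_gt0 ?normr_gt0.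
apply: (@le_trans _ _ (k1 * I1 + k2 * e ^+ 2 + k3 * l)).
  by rewrite lerD2r lerD2l ler_wpM2l.
have -> : k2 * e ^+ 2 = C * (`|h| * e ^+ 2 + e).
  by rewrite /k2; field; rewrite gt_eqF.
rewrite /k1 /k3 -!mulrA -!mulrDr ler_pM2l//.
have hI : `|h| * I1 <= e * I1 by rewrite ler_wpM2r.
have hl : `|h| * l <= e * l by rewrite ler_wpM2r// ltW.
have he : `|h| * e ^+ 2 <= e.
  by rewrite -[leRHS]mulr1 ler_pM ?sqr_ge0// expr_le1// ltW.
move: hI hl he; rewrite mulrDl [leRHS]mulrC => hI hl he; lra.
Unshelve. all: by end_near. Qed.

End EnergyDerivative.
End EdgeTimeDerivative.

(** * From Lebesgue norms to almost everywhere and integral bounds *)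

Section LebesgueNorms.
Context {R : realType}.
Implicit Types (l e : R) (u : R -> R).

(** The norm with exponent [+oo] is the essential supremum only when the whole space has positive
    measure. *)
Lemma lebesgue_measure_setT : (0 < (mu : set (measurableTypeR R) -> \bar R) setT)%E.
Proof. by rewrite -set_itvNyy lebesgue_measure_itv/= ltry. Qed.

Lemma Lp_norm_oo_ae l u (k : R) : (Lp_norm +oo l u <= k%:E)%E ->
  \forall x \ae mu, x \in `[0, l] -> `|u x| <= k.
Proof.
rewrite /Lp_norm unlock /= lebesgue_measure_setT => /ess_supP.
apply: ae_imply => x /=; rewrite /zext patchE lee_fin => + xl.
by rewrite mem_set.
Qed.

Lemma in_Loo_measurable l u : in_Lp +oo%E l u -> measurable_fun `[0, l] u.
Proof. by move=> /andP[/[!inE] mu_ _]; apply/(measurable_restrictT _ _).2. Qed.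

Lemma in_Loo_ae l u : in_Lp +oo%E l u -> exists2 k : R, 0 <= k &
  \forall x \ae mu, x \in `[0, l] -> `|u x| <= k.
Proof.
move=> /andP[_ /[!inE] uoo]; exists (fine (Lp_norm +oo l u)).
  by apply: fine_ge0; exact: Lnorm_ge0.
by apply: Lp_norm_oo_ae; rewrite fineK// ge0_fin_numE// Lnorm_ge0.
Qed.

Lemma ae_bounded_integrable l u (k : R) : measurable_fun `[0, l] u ->
  (\forall x \ae mu, x \in `[0, l] -> `|u x| <= k) -> integrable_on 0 l u.
Proof.
move=> mfu uk; apply: (ae_le_integrable mfu _ uk).
exact/continuous_on_integrable/continuous_on_cst.
Qed.

Lemma Lp_norm2_sqr l u :
  (Lp_norm 2%:E l u `^ 2 = \int[mu]_(x in `[0%R, l]) ((u x) ^+ 2)%:E)%E.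
Proof.
rewrite /Lp_norm poweR_Lnorm ?pnatr_eq0// [RHS]integral_mkcond.
apply: eq_integral => x _; rewrite /zext /= !patchE; case: ifP => // _.
  by rewrite /= powR_mulrn// -normrX ger0_norm ?sqr_ge0.
by rewrite /= normr0 powR0 ?pnatr_eq0.
Qed.

Lemma Lp_norm2_le l u e : 0 <= e -> (Lp_norm 2%:E l u <= e%:E)%E ->
  \I_(0, l) (fun x => u x ^+ 2) <= e ^+ 2.
Proof.
move=> e0 ue; have : (Lp_norm 2%:E l u `^ 2 <= (e ^+ 2)%:E)%E.
  by rewrite -powR_mulrn// -poweR_EFin gt0_ler_poweR// ?in_itv/= ?leey ?andbT
    ?Lnorm_ge0.
rewrite Lp_norm2_sqr => ie; rewrite -lee_fin /Rintegral fineK//.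
rewrite ge0_fin_numE ?(le_lt_trans ie) ?ltry//.
by apply: integral_ge0 => x _; rewrite lee_fin sqr_ge0.
Qed.

Lemma cvg0_near_le (F : set_system R) {FF : Filter F} (N : R -> \bar R) :
  N s @[s --> F] --> 0%E -> forall e, 0 < e -> \forall s \near F, (N s <= e%:E)%E.
Proof.
move=> /fine_cvgP [Nfin /cvgrPdist_le N0] e e0; near=> s.
have fN : N s \is a fin_num by near: s.
rewrite -(fineK fN) lee_fin (le_trans (ler_norm _))// -normrN -sub0r.
by near: s; exact: N0.
Unshelve. all: by end_near. Qed.

End LebesgueNorms.

(** * Network norms, and rearranging edge sums by vertices *)

Section NetworkNorms.
Context {R : realType} {G : network R}.
Implicit Types (u : netfun G) (e : edge G) (v : vertex G).

Lemma norm_Loo_edge u e : (Lp_norm +oo (len e) (u e) <= norm_Loo u)%E.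
Proof. exact: le_bigmax. Qed.

Lemma norm_L2_edge u e : (Lp_norm 2%:E (len e) (u e) <= norm_L2 u)%E.
Proof.
have N0 : (0 <= \sum_(e0 : edge G) Lp_norm 2%:E (len e0) (u e0) `^ 2)%E.
  by apply: sume_ge0 => e0 _; exact: poweR_ge0.
(* The edge norm becomes the root of its square, so that monotonicity of the root reduces the claim
   to one term of a nonnegative sum. *)
rewrite -[leLHS]poweRe1 ?Lnorm_ge0// -[X in (_ `^ X)%E](@mulfV _ (2 : R))//.
rewrite poweRrM gt0_ler_poweR ?invr_ge0// ?in_itv/= ?leey ?andbT ?poweR_ge0//.
by rewrite (bigD1 e)//= leeDl// sume_ge0// => e0 _; exact: poweR_ge0.
Qed.

Lemma normal_fst e : normal e (val e).1 = -1.
Proof. by rewrite /normal eqxx. Qed.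

Lemma edge_loopless e : (val e).2 != (val e).1.
Proof.
case: e => -[v w] /= vw; apply: contraTneq vw => ->.
exact: network_loopless.
Qed.

Lemma normal_snd e : normal e (val e).2 = 1.
Proof. by rewrite /normal (negbTE (edge_loopless e)) eqxx. Qed.

Lemma endpoint_itv e v : endpoint e v \in `[0, len e].
Proof.
have l0 := ltW (len_gt0 e).
by rewrite /endpoint; case: ifP => _; rewrite in_itv/= lexx l0.
Qed.

(** After exchanging the sums, each edge meets exactly its two end vertices, with signs -1 and 1;
    they are distinct because there are no loops. *)
Lemma sum_edge_jump (K : edge G -> R -> R) :
  \sum_(e : edge G) (K e (len e) - K e 0) =
  \sum_(v : vertex G) \sum_(e : edge G | incident e v) K e (endpoint e v) *
    normal e v.
Proof.
rewrite [RHS](exchange_big_dep xpredT)//=; apply: eq_bigr => e _.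
rewrite (bigD1 (val e).2)/=; last by rewrite /incident eqxx orbT.
rewrite (big_pred1 (val e).1) => [|v]; last first.
  rewrite /incident /=; have [->|] /= := eqVneq v (val e).1.
    by rewrite eq_sym edge_loopless.
  by rewrite andbN.
rewrite normal_fst normal_snd /endpoint eqxx (negbTE (edge_loopless e)); ring.
Qed.

End NetworkNorms.

(** * Mass conservation and energy dissipation on the network *)

Section EnergyLaw.
Context {R : realType} {G : network R}.
Variables (a b c : edge G -> R) (gamma T : R) (rho m : R -> netfun G).
Hypothesis gamma_gt1 : 1 < gamma.

Lemma derive_potential e (r : R) : 0 < r ->
  ((potential c gamma e)^`())%classic r = c e * gamma / (gamma - 1) * r `^
    (gamma - 1).
Proof.
move=> r0; have dp := is_derive1_powR gamma r0.
have d : is_derive r 1 (potential c gamma e) (c e / (gamma - 1) * (gamma * r `^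
  (gamma - 1))).
  rewrite (_ : potential c gamma e = (c e / (gamma - 1)) *: (@powR R ^~
    gamma)); last exact/funext.
  exact: is_deriveZ.
by rewrite derive1E (@derive_val _ _ _ _ _ _ _ d); ring.
Qed.

Lemma near_time_itv t : \forall s \near within `[0, T] t^', s \in `[0, T] /\ s != t.
Proof.
rewrite near_withinE; near=> s => sT; split => //.
by near: s; exact: nbhs_dnbhs_neq.
Unshelve. all: by end_near. Qed.

Lemma cvg_time t : s @[s --> within `[0, T] t^'] --> t.
Proof.
move=> A tA; do 2 apply: cvg_within; exact: tA.
Qed.

Lemma is_time_deriv_sum t (f : edge G -> R -> R) (d : edge G -> R) :
  (forall e, is_time_deriv T (f e) t (d e)) ->
  is_time_deriv T (fun s => \sum_(e : edge G) f e s) t (\sum_(e : edge G) d e).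
Proof.
move=> fd; rewrite /is_time_deriv.
rewrite (_ : (fun s => _) = fun s => \sum_(e : edge G) (f e s - f e t) / (s - t)).
  by apply: cvg_big => [|e _]; [exact: add_continuous|exact: fd].
by apply/funext => s; rewrite -sumrB mulr_suml.
Qed.

Variables (drho dm : R -> netfun G).
Hypotheses (rho_C1 : time_C1 net_Loo norm_Loo T rho drho)
  (m_C1 : time_C1 net_L2 norm_L2 T m dm)
  (rho_H1 : time_cont net_H1pos norm_H1 T rho)
  (m_H2 : time_cont net_H2 norm_H2 T m).
Variable t : R.
Hypothesis tT : 0 < t <= T.
Hypothesis flow : flow_equations a b c gamma (rho t) (m t) (drho t) (dm t).

Let t0T : t \in `[0, T].
Proof. by move: tT => /andP[t0 tT']; rewrite in_itv/= tT' ltW. Qed.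

Let drho_Loo e : in_Lp +oo%E (len e) (drho t e).
Proof. by case: rho_C1 => _ /(_ t t0T)[dr _] _; exact: dr. Qed.

Let dm_L2 e : square_integrable (len e) (dm t e).
Proof. by case: m_C1 => _ /(_ t t0T)[d _] _; apply/in_L2P; exact: d. Qed.

Let rho_Loo s e : s \in `[0, T] -> in_Lp +oo%E (len e) (rho s e).
Proof. by case: rho_C1 => r _ _ sT; exact: (r s sT). Qed.

Let m_L2 s e : s \in `[0, T] -> square_integrable (len e) (m s e).
Proof. by case: m_C1 => r _ _ sT; apply/in_L2P; exact: (r s sT). Qed.

Let rho_H1e e : in_H1 (len e) (rho t e).
Proof. by have [[h _] _] := rho_H1 t0T; exact: h. Qed.

Let m_H2e e : in_H2 (len e) (m t e).
Proof. by have [h _] := m_H2 t0T; exact: h. Qed.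

Let rho_pos : exists2 r : R, 0 < r & forall e : edge G,
  \forall x \ae mu, x \in `[0, len e] -> r <= rho t e x.
Proof. by have [[_ h] _] := rho_H1 t0T. Qed.

Let drho_int e : integrable_on 0 (len e) (drho t e).
Proof.
have [k _ dk] := in_Loo_ae (drho_Loo e).
exact: ae_bounded_integrable (in_Loo_measurable (drho_Loo e)) dk.
Qed.

Let rho_quotient e (d : R) : 0 < d ->
  \forall s \near within `[0, T] t^', \forall x \ae mu, x \in `[0, len e] ->
    `|(rho s e x - rho t e x) / (s - t) - drho t e x| <= d.
Proof.
move=> d0; have [_ _ /(_ t t0T) q] := rho_C1.
near=> s; apply: Lp_norm_oo_ae.
apply: le_trans (norm_Loo_edge (fun e x => (rho s e x - rho t e x) / (s - t) -
  drho t e x) e) _.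
by near: s; exact: cvg0_near_le.
Unshelve. all: by end_near. Qed.

Let m_quotient e (d : R) : 0 < d -> \forall s \near within `[0, T] t^',
  \I_(0, (len e)) (fun x => ((m s e x - m t e x) / (s - t) - dm t e x) ^+ 2) <=
    d ^+ 2.
Proof.
move=> d0; have [_ _ /(_ t t0T) q] := m_C1.
near=> s; apply: Lp_norm2_le (ltW d0) _.
apply: le_trans (norm_L2_edge (fun e x => (m s e x - m t e x) / (s - t) - dm t
  e x) e) _.
by near: s; exact: cvg0_near_le.
Unshelve. all: by end_near. Qed.

Let rho_int s e : s \in `[0, T] -> integrable_on 0 (len e) (rho s e).
Proof.
move=> sT; have [k _ rk] := in_Loo_ae (rho_Loo e sT).
exact: ae_bounded_integrable (in_Loo_measurable (rho_Loo e sT)) rk.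
Qed.

Lemma mass_time_deriv :
  is_time_deriv T (fun s => mass (rho s)) t
    (\sum_(e : edge G) \I_(0, (len e)) (drho t e)).
Proof.
apply: is_time_deriv_sum => e.
apply: edge_mass_deriv => //.
- exact: len_gt0.
- exact: rho_int.
- by apply: filterS (near_time_itv t) => s [sT _]; exact: rho_int.
- exact: rho_quotient.
Qed.

Lemma energy_time_deriv :
  is_time_deriv T (fun s => energy c gamma (rho s) (m s)) t
    (\sum_(e : edge G) \I_(0, (len e)) (fun x =>
       energy_power (c e) gamma (rho t e x) (m t e x) (drho t e x) (dm t e x))).
Proof.
apply: is_time_deriv_sum => e.
have [r r0 rho_ge] := rho_pos.
have [K K0 drK] := in_Loo_ae (drho_Loo e).
have [B _ rhoB] := in_Loo_ae (rho_Loo e t0T).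
(* Membership in H^1 at time [t] makes [m t e] almost everywhere equal to a continuous function,
   whence the bound [M] that L^2 would not give. *)
have [mP mE] := H1_rep (len_gt0 e) (m_H2e e).1.
have [M _ mM] := continuous_on_bounded (primitive_continuous (ltW (len_gt0 e)) mP).
apply: (edge_energy_deriv (len_gt0 e) gamma_gt1 _ _ _ (a := r) (b := B) (M :=
  M) (K := K)) => //.
- exact: cvg_time.
- by apply: filterS (near_time_itv t) => s [].
- exact: in_Loo_measurable (rho_Loo e t0T).
- exact: m_L2.
- by apply: ae_imply2 (rho_ge e) rhoB => x rx + xl => /(_ xl)/ler_normlP[_ ->];
  rewrite rx.
- by apply: ae_imply mE => x mx xl; rewrite mx// mM.
- apply: filterS (near_time_itv t) => s [sT _]; split; last exact: m_L2.
  exact: in_Loo_measurable (rho_Loo e sT).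
- exact: rho_quotient.
- exact: m_quotient.
Qed.

(** At a boundary vertex each term vanishes separately, so inner and boundary vertices obey one
    formula. *)
Let kirchhoff v :
  \sum_(e : edge G | incident e v) trace (m t) e v * normal e v = 0.
Proof.
have [iv|bv] := boolP (inner v); first exact: (flow_kirchhoff flow iv).
by apply: big1 => e ev; exact: (flow_boundary flow bv ev).
Qed.

Lemma mass_rate : \sum_(e : edge G) \I_(0, (len e)) (drho t e) = 0.
Proof.
under eq_bigr => e _ do rewrite (edge_mass_balance (len_gt0 e) (m_H2e e)
  (in_Loo_measurable (drho_Loo e)) (flow_mass flow e)).
rewrite sumrN (sum_edge_jump (fun e => cont_rep (len e) (m t e))) big1 ?oppr0//.
Qed.

Lemma energy_rate : \sum_(e : edge G) \I_(0, (len e)) (fun x =>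
    energy_power (c e) gamma (rho t e x) (m t e x) (drho t e x) (dm t e x))
  + dissipation a b (rho t) (m t) = 0.
Proof.
have [r r0 rho_ge] := rho_pos.
rewrite -big_split /=.
pose flux e x := cont_rep (len e) (m t e) x *
  (a e / cont_rep (len e) (rho t e) x ^+ 2 * cont_rep (len e) (wderiv (len e)
    (m t e)) x -
   (cont_rep (len e) (m t e) x ^+ 2 / (2 * cont_rep (len e) (rho t e) x ^+ 2) +
    c e * gamma / (gamma - 1) * cont_rep (len e) (rho t e) x `^ (gamma - 1))).
rewrite (eq_bigr (fun e => flux e (len e) - flux e 0)) => [|e _]; last first.
  exact: (edge_balance (len_gt0 e) gamma_gt1 (rho_H1e e) (m_H2e e) r0 (rho_ge e)
    (in_Loo_measurable (drho_Loo e)) (dm_L2 e).1 (flow_mass flow e)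
      (flow_momentum flow e)).
rewrite sum_edge_jump big1// => v _.
have [iv|bv] := boolP (inner v); last first.
  apply: big1 => e ev; rewrite /flux mulrAC.
  by have := flow_boundary flow bv ev; rewrite /trace => ->; rewrite mul0r.
have [h hv] := flow_coupling flow iv.
rewrite (eq_bigr (fun e => trace (m t) e v * normal e v * (- h))) => [|e ev].
  by rewrite -mulr_suml kirchhoff mul0r.
(* The formula for [P'] in the coupling condition is available at positive densities only, and the
   value at a vertex is bounded below through the continuous representative. *)
have trace_pos : 0 < trace (rho t) e v.
  exact: lt_le_trans r0 (rho_rep_ge (len_gt0 e) (rho_H1e e) (rho_ge e)
    (endpoint_itv e v)).
have := hv e ev; rewrite derive_potential// /flux /trace /bderiv => ->.
by ring.
Qed.

End EnergyLaw.

Unset Implicit Arguments.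

Theorem lemma3p2 (R : realType) (G : network R) (a b c : edge G -> R)
    (gamma T : R) (rho m : R -> netfun G)
    (ha : forall e, 0 <= a e) (hb : forall e, 0 <= b e)
    (hc : forall e, 0 < c e) (hgamma : 1 < gamma)
    (hsol : smooth_solution a b c gamma T rho m) :
  forall t : R, 0 < t <= T ->
    is_time_deriv T (fun s => mass (rho s)) t 0 /\
    exists2 dE : R,
      is_time_deriv T (fun s => energy c gamma (rho s) (m s)) t dE &
      dE + dissipation a b (rho t) (m t) = 0.
Proof.
move=> t tT; have [drho [dm [rhoC1 mC1 rhoH1 mH2 flow]]] := hsol.
have flow_t := flow t tT; split.
  have := mass_time_deriv rhoC1 tT.
  by rewrite (mass_rate rhoC1 mH2 tT flow_t).
eexists; first exact: (energy_time_deriv hgamma rhoC1 mC1 rhoH1 mH2 tT).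
exact: (energy_rate hgamma rhoC1 mC1 rhoH1 mH2 tT flow_t).
Qed.
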